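(* Let $K$ be an algebraically closed field of characteristic zero and let $X\subset \mathbb{G}_m^n$ be an algebraic set containing at least one torsion point. Let $C_1,\dots,C_m$ be torsion cosets such that $\overline{X\cap(\mathbb G_m^n)_{\mathrm{tors}}}=\bigcup_{i=1}^m C_i$ is the decomposition of the Zariski closure of $X\cap(\mathbb G_m^n)_{\mathrm{tors}}$ into irreducible components. Put $a=\max_{1\le i\le m}\dim(C_i)$ and, if $a\ge1$, $$b=\frac{1}{(a+1)\zeta(a+1)}\sum_{\substack{1\le i\le m\\ \dim(C_i)=a}}\frac{1}{\mathrm{ord}(C_i)}.$$ If $a=0$, then $\#X_T\ll_X 1$ for all $T\ge1$. If $a\ge 1$, then $$\#X_T = b\, T^{a+1}+\begin{cases}O_X(T\log(T)) & \text{if }a=1\\ O_X(T^a) & \text{if }a\ge 2\end{cases}\quad\text{as }T\to\infty.$$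
   Context: $\mathbb G_m^n=(K\setminus\{0\})^n$ with coordinate-wise multiplication; $(\mathbb G_m^n)_{\mathrm{tors}}$ is its set of elements of finite order (torsion points), and $\mathrm{ord}$ denotes the order. An algebraic set in $\mathbb G_m^n$ is the common zero set in $\mathbb G_m^n$ of finitely many Laurent polynomials in $K[X_1^{\pm1},\dots,X_n^{\pm1}]$. A linear torus is an irreducible algebraic subgroup of $\mathbb G_m^n$; a torsion coset is a set $\boldsymbol\zeta G$ with $\boldsymbol\zeta$ a torsion point and $G$ a linear torus; its order is $\mathrm{ord}(C)=\min\{\mathrm{ord}(\boldsymbol\eta):\boldsymbol\eta\in C\cap(\mathbb G_m^n)_{\mathrm{tors}}\}$. For $T\ge1$, $X_T=\{\boldsymbol\zeta\in X\cap(\mathbb G_m^n)_{\mathrm{tors}}:\mathrm{ord}(\boldsymbol\zeta)\le T\}$. In characteristic zero, by a theorem of Laurent (the Manin-Mumford Conjecture for $\mathbb G_m^n$), the irreducible components of the Zariski closure of $X\cap(\mathbb G_m^n)_{\mathrm{tors}}$ are finitely many torsion cosets, so $C_1,\dots,C_m$ exist. $\zeta(\cdot)$ in the formula for $b$ is the Riemann zeta function. Implied constants in $\ll_X$ and $O_X$ depend only on $X$. *)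

(* Defs.v *)
From HB Require Import structures.
From mathcomp Require Import all_boot all_order all_algebra finmap.
From mathcomp Require Import all_classical all_reals all_analysis.

Set Implicit Arguments.
Unset Strict Implicit.
Unset Printing Implicit Defensive.

Import Order.TTheory GRing.Theory Num.Theory.
Import numFieldNormedType.Exports.

Local Open Scope classical_set_scope.
Local Open Scope ring_scope.

(* Least and greatest element of a set of natural numbers (0 if none). *)
Definition nat_min (A : set nat) : nat :=
  xget 0%N [set m | A m /\ forall k, A k -> (m <= k)%N].
Definition nat_max (A : set nat) : nat :=
  xget 0%N [set m | A m /\ forall k, A k -> (k <= m)%N].

(* Meaningful for s > 1, where the Dirichlet series converges. *)
Definition riemann_zeta (R : realType) (s : R) : R :=
  limn (series (fun k : nat => (k.+1%:R `^ s)^-1)).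

Section Torus.
Variables (K : fieldType) (n : nat).

(* Points of the affine space K^n. The library's ring structure on finite
   functions is the pointwise one, so 1, x * y and x ^+ k are the coordinatewise
   operations. *)
Notation point := {ffun 'I_n -> K}.

Definition Gm : set point := [set x | forall i, x i != 0].

Definition torsion : set point :=
  [set x | Gm x /\ exists2 k, (0 < k)%N & x ^+ k = 1].

Definition tors_ord (x : point) : nat :=
  nat_min [set k | (0 < k)%N /\ x ^+ k = 1].

(* A Laurent polynomial is the finitely supported family of its coefficients,
   indexed by the exponent vectors in Z^n. *)
Definition laurent := {fsfun {ffun 'I_n -> int} -> K with 0}.

Definition laurent_eval (f : laurent) (x : point) : K :=
  \sum_(a <- finsupp f) f a * \prod_(i < n) x i ^ a i.

Definition algebraic (X : set point) : Prop :=
  exists (m : nat) (f : 'I_m -> laurent),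
    X = [set x | Gm x /\ forall j, laurent_eval (f j) x = 0].

Definition zariski_closure (S : set point) : set point :=
  [set x | forall X, algebraic X -> S `<=` X -> X x].

(* Irreducibility for the topology whose closed sets are the algebraic sets. *)
Definition zirreducible (S : set point) : Prop :=
  S !=set0 /\
  forall A B, algebraic A -> algebraic B ->
    S `<=` A `|` B -> S `<=` A \/ S `<=` B.

Definition irreducible_component (Y : set point) : set (set point) :=
  [set Z | [/\ Z `<=` Y, zirreducible Z &
    forall Z', zirreducible Z' -> Z' `<=` Y -> Z `<=` Z' -> Z' = Z]].

Definition irreducible_decomposition m (Y : set point)
    (C : 'I_m -> set point) : Prop :=
  [/\ injective C, range C = irreducible_component Y &
      Y = \bigcup_i C i].

(* Krull dimension: the greatest length d of a strictly increasing chain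
   Z_0 < ... < Z_d of irreducible algebraic subsets. *)
Definition has_chain (S : set point) (d : nat) : Prop :=
  exists Z : nat -> set point,
    (forall j, (j <= d)%N ->
       [/\ algebraic (Z j), zirreducible (Z j) & Z j `<=` S]) /\
    (forall j, (j < d)%N -> Z j `<` Z j.+1).

Definition krull_dim (S : set point) : nat := nat_max (has_chain S).

Definition subgroup_Gm (G : set point) : Prop :=
  [/\ G `<=` Gm, G 1, (forall x y, G x -> G y -> G (x * y)) &
      (forall x, G x -> G [ffun i => (x i)^-1])].

Definition linear_torus (G : set point) : Prop :=
  [/\ algebraic G, zirreducible G & subgroup_Gm G].

Definition torsion_coset (C : set point) : Prop :=
  exists z G, [/\ torsion z, linear_torus G & C = [set z * g | g in G]].

Definition coset_ord (C : set point) : nat :=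
  nat_min [set tors_ord x | x in C `&` torsion].

Definition torsion_upto (R : realType) (X : set point) (T : R) : set point :=
  [set x | [/\ X x, torsion x & (tors_ord x)%:R <= T]].

(* fset_set is the underlying finite set of a set that is finite, which holds
   here by finite_torsion_upto below. *)
Definition count_torsion (R : realType) (X : set point) (T : R) : nat :=
  #|` fset_set (torsion_upto X T)|.

Lemma tors_ordP (x : point) :
  torsion x -> (0 < tors_ord x)%N /\ x ^+ tors_ord x = 1.
Proof.
move=> [_ [k k0 xk]]; rewrite /tors_ord /nat_min.
case: xgetP => [m _ [[]] //|no].
have exP : exists k, (0 < k)%N && (x ^+ k == 1).
  by exists k; rewrite k0 xk eqxx.
case: (ex_minnP exP) => m /andP[m0 /eqP xm] mmin.
exfalso; apply: (no m); split=> // j [j0 xj].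
by apply: mmin; rewrite j0 xj eqxx.
Qed.

Lemma finite_torsion_upto (R : realType) (X : set point) (T : R) :
  finite_set (torsion_upto X T).
Proof.
pose N := (Num.truncn T).+1.
have TN : T < N%:R by exact: truncnS_gt.
pose p : {poly K} := 'X^(N`!) - 1.
have p0 : p != 0 by rewrite -size_poly_eq0 size_XnsubC // fact_gt0.
have fin_p : finite_set [set c | root p c].
  apply: contrapT => inf.
  have [B BA Bc] := infinite_set_fset (size p) inf.
  have sr : all (root p) B by apply/allP => c cB; apply: BA.
  by have := max_poly_roots p0 sr (fset_uniq B); rewrite ltnNge Bc.
pose E := fset_set [set c | root p c].
apply: (@sub_finite_set _ _ [set x : point | forall i, x i \in E]).
  move=> x [_ tx oT] i; rewrite in_fset_set // inE /= /root /p !hornerE.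
  have [pos_o xo] := tors_ordP tx.
  have oN : (tors_ord x <= N)%N.
    by rewrite -(ler_nat R) ltW // (le_lt_trans oT).
  have /dvdnP[q ->] : (tors_ord x %| N`!)%N by rewrite dvdn_fact // pos_o.
  have ffX k : (x ^+ k) i = x i ^+ k.
    elim: k => [|k IH]; first by rewrite ffunE.
    by rewrite !exprS ffunE IH.
  by rewrite mulnC exprM -ffX xo ffunE expr1n subrr.
have inj : injective (fun x : {ffun 'I_n -> E} => [ffun i => val (x i)] : point).
  move=> x y /ffunP xy; apply/ffunP => i; apply: val_inj.
  by have := xy i; rewrite !ffunE.
apply: (@sub_finite_set _ _
  (range (fun x : {ffun 'I_n -> E} => [ffun i => val (x i)] : point))).
  move=> x xE; exists [ffun i => [` xE i]%fset] => //.
  by apply/ffunP => i; rewrite !ffunE.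
exact/finite_image/finite_finset.
Qed.

End Torus.

(* Main.v *)
Require Import Defs.
From HB Require Import structures.
From mathcomp Require Import all_boot all_order all_algebra finmap.
From mathcomp Require Import all_classical all_reals all_analysis.
From mathcomp Require Import separable cyclotomic.
From mathcomp Require Import zify ring lra.
Set Implicit Arguments.
Unset Strict Implicit.
Unset Printing Implicit Defensive.
Import Order.TTheory GRing.Theory Num.Theory.
Import numFieldNormedType.Exports.
Local Open Scope classical_set_scope.
Local Open Scope ring_scope.

(** Every torsion point of X lies in its Zariski closure, which X contains, so
    counting torsion points on X means counting them on the union of the cosets
    C_i.

    A linear torus G is cut out by the lattice of characters that are trivial on
    it: by independence of characters, a Laurent polynomial vanishing on G also
    vanishes wherever all these characters are trivial
    ([character_relation]).  Irreducibility of G makes the lattice saturated,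
    hence spanned by part of a basis of Z^n, and this basis provides monomial
    coordinates in which G is a coordinate subtorus ([linear_torus_coset]).  A
    torsion coset C thus becomes a set of points with some coordinates
    fixed and d coordinates free.  Then d is the Krull dimension
    ([krull_dim_coset]): irreducible algebraic subsets are obtained by fixing
    more coordinates, and a chain of length D provides D algebraically
    independent regular functions on C, whereas the monomials of exponents
    less than E in these functions are combinations of only O(E^d) monomials in
    the coordinates.  Moreover ord(C) is the order e of the tuple of fixed
    coordinates, and C has N^d or 0 points killed by N, according to whether
    e divides N ([count_killed_coset]).

    Moebius inversion over the order turns these numbers into
      #C_T = e^d sum_k mu(k) (1^d + ... + M_k^d),   M_k = floor(T/(ke)),
    and the inner sum is M_k^(d+1)/(d+1) + O(M_k^d).  With
    sum_k mu(k)/k^(d+1) = 1/zeta(d+1) this gives the main term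
    T^(d+1)/(e (d+1) zeta(d+1)); the errors are of size sum_k (T/k)^d, which is
    O(T log T) for d = 1 and O(T^d) for larger d
    ([scaled_totient_sum_asymp]).

    Finally, two distinct components are not nested, so some character that is
    constant on one of them takes another value on the other, of dimension d
    say; hence their intersection has only O(N^(d-1)) points killed by N
    ([count_killed_proper_coset]), and the overlaps in the union are absorbed in
    the error term. *)

(** * Characters and monomial maps *)

Section Characters.
Variables (K : fieldType) (n : nat).
Notation point := {ffun 'I_n -> K}.
Implicit Types (x y g : point) (a b : 'rV[int]_n).

Definition chi a x : K := \prod_(i < n) x i ^ a 0 i.

Definition monomap (A : 'M[int]_n) x : point := [ffun i => chi (row i A) x].

Lemma Gm1 : Gm (1 : point).
Proof. by move=> i; rewrite ffunE oner_neq0. Qed.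

Lemma GmM x y : Gm x -> Gm y -> Gm (x * y).
Proof. by move=> gx gy i; rewrite ffunE mulf_neq0. Qed.

Lemma GmV x : Gm x -> Gm ([ffun i => (x i)^-1] : point).
Proof. by move=> gx i; rewrite ffunE invr_neq0. Qed.

Lemma mul_ffV x : Gm x -> x * [ffun i => (x i)^-1] = 1.
Proof. by move=> gx; apply/ffunP => i; rewrite !ffunE divff. Qed.

Lemma ffun_expE x k i : (x ^+ k) i = x i ^+ k.
Proof.
elim: k => [|k IH]; first by rewrite ffunE.
by rewrite !exprS ffunE IH.
Qed.

Lemma chi_neq0 a x : Gm x -> chi a x != 0.
Proof. by move=> gx; apply/prodf_neq0 => i _; rewrite expfz_neq0. Qed.

Lemma chi0 x : chi 0 x = 1.
Proof. by rewrite /chi big1 // => i _; rewrite mxE expr0z. Qed.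

Lemma chiD a b x : Gm x -> chi (a + b) x = chi a x * chi b x.
Proof.
by move=> gx; rewrite /chi -big_split; apply: eq_bigr => i _; rewrite mxE expfzDr.
Qed.

Lemma chiZ k a x : chi (k *: a) x = chi a x ^ k.
Proof.
have -> : chi a x ^ k = \prod_(i < n) (x i ^ a 0 i) ^ k.
  exact: (big_morph (fun u : K => u ^ k) (fun u v => expfzMl u v k) (exp1rz K k)).
by apply: eq_bigr => i _; rewrite mxE exprz_exp mulrC.
Qed.

Lemma chiN a x : chi (- a) x = (chi a x)^-1.
Proof. by rewrite -scaleN1r chiZ exprN1. Qed.

Lemma chi_sum (I : Type) (r : seq I) (P : pred I) (F : I -> 'rV[int]_n) x :
  Gm x -> chi (\sum_(i <- r | P i) F i) x = \prod_(i <- r | P i) chi (F i) x.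
Proof.
move=> gx; apply: (big_morph (fun a => chi a x)) => [a b|]; last exact: chi0.
exact: chiD.
Qed.

Lemma chi1 a : chi a 1 = 1.
Proof. by rewrite /chi big1 // => i _; rewrite ffunE exp1rz. Qed.

Lemma chiM a x y : chi a (x * y) = chi a x * chi a y.
Proof.
by rewrite /chi -big_split; apply: eq_bigr => i _; rewrite ffunE expfzMl.
Qed.

Lemma chiX a x k : chi a (x ^+ k) = chi a x ^+ k.
Proof. by elim: k => [|k IH]; rewrite ?expr0 ?chi1 // !exprS chiM IH. Qed.

Lemma Gm_monomap A x : Gm x -> Gm (monomap A x).
Proof. by move=> gx i; rewrite ffunE chi_neq0. Qed.

Lemma monomap1 A : monomap A 1 = 1.
Proof. by apply/ffunP => i; rewrite !ffunE chi1. Qed.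

Lemma monomapM A x y : monomap A (x * y) = monomap A x * monomap A y.
Proof. by apply/ffunP => i; rewrite !ffunE chiM. Qed.

Lemma monomapX A x k : monomap A (x ^+ k) = monomap A x ^+ k.
Proof. by apply/ffunP => i; rewrite ffun_expE !ffunE chiX. Qed.

Lemma chi_monomap a A x : Gm x -> chi a (monomap A x) = chi (a *m A) x.
Proof.
move=> gx; rewrite mulmx_sum_row chi_sum //.
by apply: eq_bigr => i _; rewrite ffunE chiZ.
Qed.

Lemma monomap_mul A B x : Gm x -> monomap (A *m B) x = monomap A (monomap B x).
Proof. by move=> gx; apply/ffunP => i; rewrite !ffunE row_mul chi_monomap. Qed.

Lemma monomap_id x : monomap 1%:M x = x.
Proof.
apply/ffunP => i; rewrite ffunE /chi (bigD1 i) //= big1 ?mulr1.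
  by rewrite !mxE eqxx expr1z.
by move=> j ji; rewrite !mxE eq_sym (negPf ji) expr0z.
Qed.

Lemma monomapK A x : A \in unitmx -> Gm x -> monomap (invmx A) (monomap A x) = x.
Proof. by move=> uA gx; rewrite -monomap_mul // mulVmx // monomap_id. Qed.

Lemma monomapVK A x : A \in unitmx -> Gm x -> monomap A (monomap (invmx A) x) = x.
Proof. by move=> uA gx; rewrite -monomap_mul // mulmxV // monomap_id. Qed.

Lemma torsion_monomap A x : torsion x -> torsion (monomap A x).
Proof.
move=> [gx [k k0 xk]]; split; first exact: Gm_monomap.
by exists k => //; rewrite -monomapX xk monomap1.
Qed.

Lemma monomap_expr_eq1 A x k : A \in unitmx -> Gm x ->
  (monomap A x ^+ k = 1) <-> (x ^+ k = 1).
Proof.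
move=> uA gx; rewrite -monomapX; split=> [e|->]; last exact: monomap1.
have gxk : Gm (x ^+ k) by move=> i; rewrite ffun_expE expf_neq0.
by rewrite -(monomapK uA gxk) e monomap1.
Qed.

End Characters.

(** * Regular functions *)

Section Regular.
Variables (K : fieldType) (n : nat).
Notation point := {ffun 'I_n -> K}.
Implicit Types (x y g : point) (a b : 'rV[int]_n) (h : point -> K).
Implicit Types (s : seq (K * 'rV[int]_n)).

Definition lsum s x : K := \sum_(t <- s) t.1 * chi t.2 x.

Definition ebounded (B : nat) s :=
  all (fun t : K * 'rV[int]_n => [forall i, `|t.2 0 i| <= B%:Z]) s.

(** The bound on the exponents is kept because the upper bound for the Krull
    dimension counts the characters that can occur. *)
Definition regular_le (B : nat) h :=
  exists2 s, ebounded B s & forall x, Gm x -> h x = lsum s x.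

Definition regular h := exists s, forall x, Gm x -> h x = lsum s x.

Lemma regular_bounded h : regular h -> exists B, regular_le B h.
Proof.
move=> [s hs]; exists (\max_(t <- s) \max_i `|t.2 ord0 i|%N)%N, s => //.
apply/allP => t ts; apply/forallP => i.
rewrite -abszE lez_nat.
apply: leq_trans (leq_bigmax_seq _ ts isT).
exact: (@leq_bigmax _ (fun i => `|t.2 ord0 i|%N) i).
Qed.

Lemma regular_leW B h : regular_le B h -> regular h.
Proof. by move=> [s _ hs]; exists s. Qed.

Lemma lsum_nil x : lsum [::] x = 0. Proof. exact: big_nil. Qed.
Lemma lsum_cons t s x : lsum (t :: s) x = t.1 * chi t.2 x + lsum s x.
Proof. exact: big_cons. Qed.
Lemma lsum_cat s1 s2 x : lsum (s1 ++ s2) x = lsum s1 x + lsum s2 x.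
Proof. exact: big_cat. Qed.

Lemma regular_leS B B' h : (B <= B')%N -> regular_le B h -> regular_le B' h.
Proof.
move=> BB [s bs hs]; exists s => //; apply: sub_all bs => t /forallP bt.
by apply/forallP => i; apply: le_trans (bt i) _; rewrite lez_nat.
Qed.

Lemma regular_le_cst c : regular_le 0 (fun=> c).
Proof.
exists [:: (c, 0)]; first by rewrite /= andbT; apply/forallP => i; rewrite mxE normr0.
by move=> x _; rewrite lsum_cons lsum_nil /= chi0 mulr1 addr0.
Qed.

Lemma regular_leM B B' h h' : regular_le B h -> regular_le B' h' ->
  regular_le (B + B') (fun x => h x * h' x).
Proof.
move=> [s bs hs] [s' bs' hs'].
exists [seq (t.1 * t'.1, t.2 + t'.2) | t <- s, t' <- s'].
  apply/allP => _ /allpairsP[[t t'] /= [ts ts' ->]] /=.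
  apply/forallP => i; rewrite mxE PoszD (le_trans (ler_normD _ _)) // lerD //.
  - by move/allP: bs => /(_ _ ts) /forallP.
  - by move/allP: bs' => /(_ _ ts') /forallP.
move=> x gx; rewrite hs // hs' // /lsum big_allpairs_dep /= big_distrl /=.
apply: eq_bigr => t _; rewrite big_distrr /=; apply: eq_bigr => t' _.
by rewrite chiD // mulrACA.
Qed.

Lemma regular_leX B h k : regular_le B h -> regular_le (k * B) (fun x => h x ^+ k).
Proof.
move=> rh; elim: k => [|k IH]; first exact: regular_le_cst.
have -> : (fun x => h x ^+ k.+1) = (fun x => h x * h x ^+ k).
  by apply/funext => x; rewrite exprS.
by rewrite mulSn; apply: regular_leM.
Qed.

Lemma regularM h h' : regular h -> regular h' -> regular (fun x => h x * h' x).
Proof.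
move=> /regular_bounded[B rh] /regular_bounded[B' rh'].
by apply: regular_leW (regular_leM rh rh').
Qed.

Lemma regularX h k : regular h -> regular (fun x => h x ^+ k).
Proof. by move=> /regular_bounded[B rh]; apply: regular_leW (regular_leX k rh). Qed.

Lemma regular_cst c : regular (fun=> c).
Proof. exact: regular_leW (regular_le_cst c). Qed.

Lemma regularD h h' : regular h -> regular h' -> regular (fun x => h x + h' x).
Proof.
move=> [s hs] [s' hs']; exists (s ++ s') => x gx.
by rewrite lsum_cat hs // hs'.
Qed.

Lemma regular_sum (I : Type) (r : seq I) (P : pred I) (F : I -> point -> K) :
  (forall i, regular (F i)) -> regular (fun x => \sum_(i <- r | P i) F i x).
Proof.
move=> rF; elim: r => [|i r IH].
  have -> : (fun x => \sum_(i <- [::] | P i) F i x) = (fun=> 0).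
    by apply/funext => x; rewrite big_nil.
  exact: regular_cst.
have -> : (fun x => \sum_(i <- i :: r | P i) F i x) =
    (fun x => (if P i then F i x else 0) + \sum_(i <- r | P i) F i x).
  by apply/funext => x; rewrite big_cons; case: ifP => // _; rewrite add0r.
by apply: regularD IH; case: (P i); [exact: rF|exact: regular_cst].
Qed.

Lemma regular_chi a : regular (chi a).
Proof.
exists [:: (1, a)] => x _.
by rewrite lsum_cons lsum_nil /= mul1r addr0.
Qed.

Lemma regular_monomap A h : regular h -> regular (fun y => h (monomap A y)).
Proof.
move=> [s hs]; exists [seq (t.1, t.2 *m A) | t <- s] => y gy.
rewrite hs; last exact: Gm_monomap.
by rewrite /lsum big_map; apply: eq_bigr => t _ /=; rewrite chi_monomap.
Qed.

Lemma laurent_eval_regular (f : laurent K n) : regular (laurent_eval f).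
Proof.
exists [seq (f v, \row_i (v i)) | v <- finsupp f] => x gx.
rewrite /lsum big_map; apply: eq_bigr => v _ /=; congr (_ * _).
by apply: eq_bigr => i _; rewrite mxE.
Qed.

Lemma regular_laurent h : regular h ->
  exists f : laurent K n, forall x, Gm x -> laurent_eval f x = h x.
Proof.
move=> [s hs].
pose e (t : K * 'rV[int]_n) : {ffun 'I_n -> int} := [ffun i => t.2 0 i].
pose S : {fset {ffun 'I_n -> int}} := [fset v | v in map e s]%fset.
pose F (v : {ffun 'I_n -> int}) : K := \sum_(t <- s | e t == v) t.1.
pose f : laurent K n := [fsfun[fsfun_key] v in S => F v | 0].
exists f => x gx; rewrite hs //.
(* the support of f may be smaller than S, as coefficients can cancel *)
have -> : laurent_eval f x = \sum_(v <- S) F v * \prod_(i < n) x i ^ v i.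
  rewrite /laurent_eval (big_fset_incl _ (finsupp_sub _ _ _)) /=.
    by apply: eq_big_seq => v vS; rewrite fsfun_fun vS.
  by move=> v vS; rewrite mem_finsupp negbK => /eqP ->; rewrite mul0r.
rewrite /F; under eq_bigr do rewrite big_distrl /= big_mkcond /=.
rewrite exchange_big /=; apply: eq_big_seq => t ts.
have etS : e t \in S by rewrite !inE map_f.
rewrite (big_fsetD1 _ etS) /= eqxx [X in _ + X]big1_seq ?addr0.
  by congr (_ * _); apply: eq_bigr => i _; rewrite ffunE.
by move=> v; rewrite !inE eq_sym => /andP[_ /andP[/negPf -> _]].
Qed.

Lemma algebraic_regular (m : nat) (h : 'I_m -> point -> K) :
  (forall j, regular (h j)) -> algebraic [set x | Gm x /\ forall j, h j x = 0].
Proof.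
move=> rh; have /choice [f fE] := fun j => regular_laurent (rh j).
exists m, f; apply/seteqP; split=> x [gx hx]; split=> // j.
- by rewrite fE.
- by rewrite -fE.
Qed.

Lemma algebraic_sep X x : algebraic X -> Gm x -> ~ X x ->
  exists h, [/\ regular h, forall y, X y -> h y = 0 & h x != 0].
Proof.
move=> [m [f ->]] gx nx.
have /existsNP[j /eqP hj] : ~ forall j, laurent_eval (f j) x = 0.
  by move=> fx; apply: nx; split.
exists (laurent_eval (f j)); split => //; first exact: laurent_eval_regular.
by move=> y [].
Qed.

(** The zero sets of h and h' are algebraic and cover S: the regular
    functions on an irreducible set form an integral domain. *)
Lemma irreducible_mul_eq0 S h h' : S `<=` @Gm K n -> zirreducible S ->
  regular h -> regular h' -> (forall x, S x -> h x * h' x = 0) ->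
  (forall x, S x -> h x = 0) \/ (forall x, S x -> h' x = 0).
Proof.
move=> SG [_ irrS] rh rh' hh'.
have alg u : regular u -> algebraic [set x | Gm x /\ forall j : 'I_1, u x = 0].
  by move=> ru; apply: algebraic_regular.
case: (irrS _ _ (alg _ rh) (alg _ rh')) => [x Sx|H|H].
- have /eqP := hh' x Sx; rewrite mulf_eq0 => /orP[/eqP e|/eqP e].
    by left; split=> //; apply: SG.
  by right; split=> //; apply: SG.
- by left => x /H[_ /(_ ord0)].
- by right => x /H[_ /(_ ord0)].
Qed.

End Regular.

(** * Lattices and linear tori *)

Section Lattice.
Variable n : nat.
Implicit Types (a c : 'rV[int]_n).

(** Take a matrix M with rows in L whose rank is as large as possible, so that
    its rows span L over the rationals, and write it in Smith normal form
    U D A.  The rows of D A are multiples of those rows of A that correspond to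
    nonzero diagonal entries, so the latter are in L by saturation, and they
    span L over the integers because A is unimodular. *)
Lemma saturated_lattice_basis (L : 'rV[int]_n -> Prop) :
    L 0 -> (forall a c, L a -> L c -> L (a + c)) ->
    (forall (k : int) a, L a -> L (k *: a)) ->
    (forall (k : int) a, k != 0 -> L (k *: a) -> L a) ->
  exists (A : 'M[int]_n) (J : {set 'I_n}), A \in unitmx /\
    forall a, L a <-> forall i, i \notin J -> (a *m invmx A) 0 i = 0.
Proof.
move=> L0 LD LZ Lsat.
have Lsum (I : Type) (r : seq I) (P : pred I) (F : I -> 'rV[int]_n) :
    (forall i, P i -> L (F i)) -> L (\sum_(i <- r | P i) F i).
  by move=> LF; apply: big_ind.
pose Q k (M : 'M[int]_(k, n)) := map_mx intr M : 'M[rat]_(k, n).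
pose P r := `[< exists k (M : 'M[int]_(k, n)),
  (forall i, L (row i M)) /\ \rank (Q k M) = r >].
have exP : exists r, P r.
  exists (\rank (Q 0%N 0)); apply/asboolP; exists 0%N, 0; split=> // -[] //.
have Pn r : P r -> (r <= n)%N.
  by move=> /asboolP[k [M [_ <-]]]; apply: rank_leq_col.
case: (ex_maxnP exP Pn) => r /asboolP[k [M [LM rM]]] rmax.
have span a : L a -> (Q 1%N a <= Q k M)%MS.
  move=> La.
  have sub : (Q k M <= Q k M + Q 1%N a)%MS by apply: addsmxSl.
  have le : (\rank (Q k M + Q 1%N a)%MS <= \rank (Q k M))%N.
    rewrite rM; apply: rmax; apply/asboolP; exists (k + 1)%N, (col_mx M a).
    split=> [i|]; last by rewrite /Q map_col_mx addsmxE.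
    case: (splitP i) => j ij.
      have -> : i = lshift 1 j by apply: val_inj.
      by rewrite rowKu.
    have -> : i = rshift k j by apply: val_inj.
    by rewrite rowKd (_ : row j a = a) //; apply/rowP => l; rewrite mxE ord1.
  have := mxrank_leqif_sup sub; move=> /geq_leqif; rewrite le => /esym.
  by apply: submx_trans; apply: addsmxSr.
have [U uU [A uA [d _ MUA]]] := int_Smith_normal_form M.
set D := (X in U *m X *m A) in MUA.
have LDA i : L (row i (D *m A)).
  have -> : D *m A = invmx U *m M by rewrite MUA -mulmxA mulKmx.
  rewrite row_mul mulmx_sum_row; apply: Lsum => j _; exact/LZ/LM.
pose J : {set 'I_n} := [set i : 'I_n | (i < k)%N && (d`_i != 0)]%SET.
exists A, J; split=> // a; split.
  move=> /span /submxP[u ua] j; rewrite inE negb_and negbK => jJ.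
  have E : map_mx intr (a *m invmx A) = u *m map_mx intr U *m map_mx intr D :> 'rV[rat]_n.
    have : map_mx intr (a *m invmx A) *m map_mx intr A =
           u *m map_mx intr U *m map_mx intr D *m map_mx intr A :> 'rV[rat]_n.
      by rewrite -map_mxM mulmxKV // -/(Q 1%N a) ua /Q MUA !map_mxM /= !mulmxA.
    move=> /(congr1 (fun X => X *m map_mx intr (invmx A))).
    by rewrite -!mulmxA -!map_mxM /= mulmxV // !mulmx1 => ->; rewrite map_mxM.
  have : (map_mx intr (a *m invmx A) : 'rV[rat]_n) 0 j = 0.
    rewrite E mxE big1 // => i _; rewrite !mxE.
    have [ij|] := eqVneq (i : nat) j; last by rewrite mulr0n mulr0.
    move: jJ; rewrite -ij -leqNgt leqNgt ltn_ord /= => /eqP ->.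
    by rewrite mul0rn mulr0.
  by rewrite mxE => /eqP; rewrite intr_eq0 => /eqP.
move=> aJ; rewrite -(mulmxKV uA a) mulmx_sum_row; apply: Lsum => i _.
have [|iJ] := boolP (i \in J); last first.
  by rewrite aJ // scale0r.
rewrite inE => /andP[ik di]; apply: LZ; apply: Lsat di _.
have := LDA (Ordinal ik); rewrite row_mul mulmx_sum_row (bigD1 i) //= big1 ?addr0.
  by rewrite !mxE eqxx mulr1n.
by move=> j ji; rewrite !mxE eq_sym (negPf (_ : (j : nat) != i)) ?mulr0n ?scale0r.
Qed.

End Lattice.

Section TorusStructure.
Variables (K : fieldType) (n : nat).
Notation point := {ffun 'I_n -> K}.
Implicit Types (x y g : point) (a b : 'rV[int]_n).

(** Comparing a sum of characters with its translate by g kills the term t. *)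
Lemma lsum_twist (s : seq (K * 'rV[int]_n)) t g : t \in s ->
  exists2 s', (size s' < size s)%N & forall x,
    lsum s' x = lsum s (g * x) - chi t.2 g * lsum s x.
Proof.
move=> ts; exists [seq (u.1 * (chi u.2 g - chi t.2 g), u.2) | u <- rem t s].
  by rewrite size_map size_rem // ltn_predL; case: s ts.
move=> x; transitivity (\sum_(u <- s) u.1 * (chi u.2 g - chi t.2 g) * chi u.2 x).
  rewrite [RHS](perm_big _ (perm_to_rem ts)) big_cons /= subrr mulr0 mul0r add0r.
  by rewrite /lsum big_map.
rewrite /lsum big_distrr /= -sumrB; apply: eq_bigr => u _.
by rewrite chiM; ring.
Qed.

(** Artin's independence of characters: grouping the terms of a relation
    according to the restriction of their characters to G, each group has
    coefficient sum zero, so the relation persists wherever the characters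
    trivial on G are trivial.  The induction removes one of two terms whose
    characters differ at some g by comparing the relation with its translate
    by g; doing this for both terms and subtracting recovers the relation. *)
Lemma character_relation (G : set point) (s : seq (K * 'rV[int]_n)) x :
    subgroup_Gm G -> (forall g, G g -> lsum s g = 0) ->
    Gm x -> (forall a, (forall g, G g -> chi a g = 1) -> chi a x = 1) ->
  lsum s x = 0.
Proof.
move=> [GG G1 GM _] + gx triv; have [m] := ubnP (size s).
elim: m s => // m IH [|t0 s] //= sm s0; first by rewrite lsum_nil.
have [same|] := pselect (forall t g, t \in s -> G g -> chi t.2 g = chi t0.2 g).
  have factor y : (forall t, t \in s -> chi t.2 y = chi t0.2 y) ->
      lsum (t0 :: s) y = (\sum_(t <- t0 :: s) t.1) * chi t0.2 y.
    move=> sy; rewrite /lsum big_distrl /=; apply: eq_big_seq => t.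
    by rewrite inE => /orP[/eqP -> //|/sy ->].
  have := s0 1 G1; rewrite factor; last by move=> t ts; rewrite !chi1.
  rewrite chi1 mulr1 => c0; rewrite factor ?c0 ?mul0r // => t ts.
  have : chi (t.2 - t0.2) x = 1.
    apply: triv => g Gg; have gg := GG _ Gg.
    by rewrite chiD // chiN (same t g ts Gg) divff ?chi_neq0.
  rewrite chiD // chiN => /(congr1 (fun u => u * chi t0.2 x)).
  by rewrite mulfVK ?chi_neq0 // mul1r.
move=> /existsNP[t1 /existsNP[g /not_implyP[t1s /not_implyP[Gg /eqP ne]]]].
have twist t : t \in t0 :: s -> lsum (t0 :: s) (g * x) = chi t.2 g * lsum (t0 :: s) x.
  move=> ts; have [s' ss' s'E] := lsum_twist g ts.
  apply/eqP; rewrite -subr_eq0 -s'E; apply/eqP/IH; first exact: leq_trans ss' _.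
  by move=> y Gy; rewrite s'E !s0 ?mulr0 ?subr0 //; apply: GM.
have := twist t1; rewrite inE t1s orbT (twist t0) ?mem_head // => /(_ isT) /eqP.
rewrite -subr_eq0 -mulrBl mulf_eq0 subr_eq0 eq_sym (negPf ne) /=.
by move=> /eqP.
Qed.

(** For A in GL_n(Z) this is a coset of a coordinate subtorus in the monomial
    coordinates given by A; the free coordinates are those outside J. *)
Definition coset (A : 'M[int]_n) (w : point) (J : {set 'I_n}) : set point :=
  [set x | Gm x /\ forall i, i \in J -> monomap A x i = w i].

Hypothesis K_char0 : [pchar K] =i pred0.

(** A linear torus G is cut out by its annihilator, the lattice of characters
    trivial on G, by independence of characters.  Irreducibility of G makes this
    lattice saturated: if the k-th power of a character c is trivial on G then
    (c - 1)(1 + c + ... + c^(k-1)) vanishes on G, while the second factor is k at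
    the identity.  A saturated lattice is spanned by part of a basis of Z^n. *)
Lemma linear_torus_coset (G : set point) : linear_torus G ->
  exists A J, A \in unitmx /\ G = coset A 1 J.
Proof.
move=> [Galg Girr Gsub]; have [GG G1 GM GV] := Gsub.
pose L a := forall g, G g -> chi a g = 1.
have [||k a La g Gg|k a k0 La|A [J [uA AJ]]] := @saturated_lattice_basis n L.
- by move=> g _; rewrite chi0.
- by move=> a b La Lb g Gg; rewrite chiD ?La ?Lb ?mulr1 //; apply: GG.
- by rewrite chiZ La // exp1rz.
- have Lk g : G g -> chi a g ^+ `|k|%N = 1.
    move=> Gg; have := La g Gg; rewrite chiZ; case: (k) => // j.
    by move=> /(congr1 GRing.inv); rewrite invrK invr1.
  case: (@irreducible_mul_eq0 K n G (fun g => chi a g - 1)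
    (fun g => \sum_(i < `|k|%N) chi a g ^+ i)) => //.
  + by apply: regularD; [exact: regular_chi|exact: regular_cst].
  + by apply: regular_sum => i; apply/regularX/regular_chi.
  + by move=> g Gg; rewrite -subrX1 Lk // subrr.
  + by move=> H g Gg; apply/eqP; rewrite -subr_eq0 H.
  move=> /(_ 1 G1); rewrite (eq_bigr (fun=> 1)); last first.
    by move=> i _; rewrite chi1 expr1n.
  rewrite sumr_const card_ord => /eqP; rewrite (pcharf0P K).1 //.
  by rewrite absz_eq0 (negPf k0).
exists A, J; split=> //; apply/seteqP; split=> x.
  move=> Gx; split=> [|i iJ]; first exact: GG.
  rewrite !ffunE; suff La : L (row i A) by exact: La.
  apply: (iffRL (AJ _)) => j jJ.
  rewrite -row_mul mulmxV // !mxE; case: eqP => // ij.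
  by rewrite -ij iJ in jJ.
move=> [gx xJ]; have [m [f Gf]] := Galg.
rewrite Gf; split=> // j; have [s sE] := laurent_eval_regular (f j); rewrite sE //.
apply: (@character_relation G) => //.
  by move=> g; rewrite Gf => -[gg fg]; rewrite -sE.
move=> a La; have aJ := iffLR (AJ a) La; rewrite -(mulmxKV uA a) -chi_monomap // /chi big1 // => i _.
have [iJ|iJ] := boolP (i \in J); last by rewrite aJ // expr0z.
by rewrite xJ // ffunE exp1rz.
Qed.

(** Setting the free coordinates of w to 1 makes the order of w depend on the
    coset only. *)
Lemma torsion_coset_coset (C : set point) : torsion_coset C ->
  exists A w (J : {set 'I_n}), [/\ A \in unitmx, torsion w, forall i, i \notin J -> w i = 1
    & C = coset A w J].
Proof.
move=> [z [G [[gz [k k0 zk]] /linear_torus_coset[A [J [uA ->]]] ->]]].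
have wk : monomap A z ^+ k = 1 by rewrite -monomapX zk monomap1.
exists A, [ffun i => if i \in J then monomap A z i else 1], J; split=> //.
- split=> [i|].
    by rewrite ffunE; case: ifP => _; [exact: Gm_monomap|exact: oner_neq0].
  exists k => //; apply/ffunP => i; rewrite ffun_expE [in LHS]ffunE.
  by case: ifP => _; [rewrite -ffun_expE wk|rewrite expr1n ffunE].
- by move=> i iJ; rewrite ffunE (negPf iJ).
apply/seteqP; split=> x.
  move=> [g [gg gJ] <-]; split=> [|i iJ]; first exact: GmM.
  rewrite monomapM [RHS]ffunE [LHS]ffunE iJ gJ //.
  by rewrite [X in _ * X]ffunE mulr1.
move=> [gx xJ]; exists ([ffun i => (z i)^-1] * x); last first.
  by rewrite mulrA mul_ffV // mul1r.
have gV := GmV gz; split=> [|i iJ]; first exact: GmM.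
rewrite monomapM [LHS]ffunE xJ // [X in _ * X]ffunE iJ.
have := congr1 (fun u : point => u i) (monomapM A z [ffun i => (z i)^-1]).
by rewrite mul_ffV // monomap1 [RHS]ffunE mulrC => <-; rewrite ffunE.
Qed.

End TorusStructure.

(** * Irreducibility and dimension of cosets *)

Section CosetGeometry.
Variables (K : fieldType) (n : nat).
Hypothesis K_char0 : [pchar K] =i pred0.
Notation point := {ffun 'I_n -> K}.
Implicit Types (x y w : point) (a : 'rV[int]_n) (A : 'M[int]_n)
  (J : {set 'I_n}).

Lemma natr_neq0_char0 k : (0 < k)%N -> k%:R != 0 :> K.
Proof. by move=> k0; rewrite (pcharf0P K).1 // -lt0n. Qed.

Lemma poly_nonroot (P : {poly K}) : P != 0 -> exists t, P.[t] != 0.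
Proof.
move=> P0; apply: contrapT => /forallNP none.
pose r : seq K := [seq k%:R | k <- iota 0 (size P)].
have ur : uniq r.
  rewrite map_inj_in_uniq ?iota_uniq // => i j _ _ ij.
  wlog le_ij : i j ij / (i <= j)%N.
    by move=> H; case: (leqP i j) => [/(H _ _ ij)//|/ltnW/(H _ _ (esym ij))].
  apply/eqP; rewrite eqn_leq le_ij /= leqNgt -subn_gt0; apply/negP => /natr_neq0_char0.
  by rewrite natrB // ij subrr eqxx.
have ar : all (root P) r by apply/allP => t _; apply: negbNE; apply/negP; apply: none.
by have := max_poly_roots P0 ar ur; rewrite size_map size_iota ltnn.
Qed.

Lemma coset_sub_Gm A w J : coset A w J `<=` @Gm K n.
Proof. by move=> x []. Qed.

Lemma algebraic_coset A w J : algebraic (coset A w J).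
Proof.
have -> : coset A w J = [set x | Gm x /\ forall i : 'I_n,
    (if i \in J then chi (row i A) x - w i else 0) = 0].
  apply/seteqP; split=> x [gx xJ]; split=> // i.
    by case: ifP => // /xJ; rewrite ffunE => ->; rewrite subrr.
  by move=> iJ; have := xJ i; rewrite iJ ffunE => /eqP; rewrite subr_eq0 => /eqP.
apply: algebraic_regular => i; case: (i \in J); last exact: regular_cst.
by apply: regularD; [exact: regular_chi|exact: regular_cst].
Qed.

Definition segment (p q : point) (t : K) : point := [ffun i => p i + t * (q i - p i)].

Definition segment_poly (p q : point) i : {poly K} := (p i)%:P + (q i - p i)%:P * 'X.

Lemma horner_segment (p q : point) i t : (segment_poly p q i).[t] = segment p q t i.
Proof. by rewrite /segment_poly !hornerE ffunE mulrC. Qed.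

(** A regular function restricted to a line is, up to the powers of the
    coordinates needed to clear its denominators, a polynomial. *)
Lemma regular_segment (h : point -> K) (p q : point) : regular h ->
  exists P : {poly K}, forall t, Gm (segment p q t) ->
    (P.[t] == 0) = (h (segment p q t) == 0).
Proof.
move=> /regular_bounded[B [s bs hs]].
exists (\sum_(u <- s) u.1%:P * \prod_i segment_poly p q i ^+ `|(u.2 0 i + B%:Z)%R|%N) => t gt.
set y := segment p q t in gt *.
have prodB : \prod_i y i ^+ B != 0.
  by apply/prodf_neq0 => i _; rewrite expf_neq0.
have -> : (h y == 0) = (h y * \prod_i y i ^+ B == 0).
  by rewrite mulf_eq0 (negPf prodB) orbF.
rewrite hs // /lsum big_distrl horner_sum /=; congr (_ == 0).
apply: eq_big_seq => u us; rewrite !hornerE horner_prod -mulrA; congr (_ * _).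
rewrite -big_split /=; apply: eq_bigr => i _; rewrite horner_exp horner_segment.
have /forallP /(_ i) bu := allP bs _ us.
have pos : 0 <= u.2 0 i + B%:Z.
  by move: bu; rewrite ler_norml -subr_ge0 opprK => /andP[].
by rewrite !exprnP -expfzDr // gez0_abs.
Qed.

(** Two regular functions, nonzero at the points p and q of the coset
    respectively, are both nonzero at some point of the line that joins p and
    q in the coordinates where the coset is an open part of an affine
    subspace: on this line they are nonzero polynomials. *)
Lemma irreducible_coset A w J : A \in unitmx -> Gm w -> zirreducible (coset A w J).
Proof.
move=> uA gw; split.
  exists (monomap (invmx A) w); split; first exact: Gm_monomap.
  by move=> i _; rewrite monomapVK.
move=> X Y algX algY SXY; apply: contrapT => /not_orP[/existsNP[p /not_implyP[Sp Xp]]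
  /existsNP[q /not_implyP[Sq Yq]]].
have [[gp pJ] [gq qJ]] := (Sp, Sq).
have [f [rf fX fp]] := algebraic_sep algX gp Xp.
have [h [rh hY hq]] := algebraic_sep algY gq Yq.
pose p' := monomap A p; pose q' := monomap A q.
have [gp' gq'] : Gm p' /\ Gm q' by split; apply: Gm_monomap.
have [Pf PfE] := regular_segment p' q' (regular_monomap (invmx A) rf).
have [Ph PhE] := regular_segment p' q' (regular_monomap (invmx A) rh).
have s0 : segment p' q' 0 = p' by apply/ffunP => i; rewrite ffunE mul0r addr0.
have s1 : segment p' q' 1 = q' by apply/ffunP => i; rewrite ffunE mul1r addrC subrK.
have Pf0 : Pf != 0.
  apply: contraNneq fp => Pf0; have := PfE 0; rewrite s0 => /(_ gp').
  by rewrite Pf0 horner0 eqxx monomapK // => /esym.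
have Ph0 : Ph != 0.
  apply: contraNneq hq => Ph0; have := PhE 1; rewrite s1 => /(_ gq').
  by rewrite Ph0 horner0 eqxx monomapK // => /esym.
pose V : {poly K} := \prod_i segment_poly p' q' i.
have VE t : V.[t] = \prod_i segment p' q' t i.
  by rewrite horner_prod; apply: eq_bigr => i _; rewrite horner_segment.
have V0 : V != 0.
  apply/eqP => V0; have := VE 0; rewrite V0 horner0 s0 => /esym/eqP.
  by apply/negP/prodf_neq0 => i _.
have [t] := poly_nonroot (mulf_neq0 V0 (mulf_neq0 Pf0 Ph0)).
rewrite !hornerM !mulf_eq0 !negb_or VE => /and3P[/prodf_neq0 gy Pft Pht].
set y := segment p' q' t in gy.
have gy' : Gm y by move=> i; exact: gy.
rewrite PfE // in Pft; rewrite PhE // in Pht.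
case: (SXY (monomap (invmx A) y)).
- split=> [|i iJ]; first exact: Gm_monomap.
  by rewrite monomapVK // ffunE /p' /q' pJ // qJ // subrr mulr0 addr0.
- by move=> /fX /eqP; apply/negP.
- by move=> /hY /eqP; apply/negP.
Qed.

Lemma nat_maxE (S : set nat) k : S k -> (forall j, S j -> (j <= k)%N) -> nat_max S = k.
Proof.
move=> Sk kmax; rewrite /nat_max; case: xgetP => [m _ [Sm mmax]|/(_ k)[]//].
by apply/eqP; rewrite eqn_leq kmax //= mmax.
Qed.

Lemma nat_minE (S : set nat) k : S k -> (forall j, S j -> (k <= j)%N) -> nat_min S = k.
Proof.
move=> Sk kmin; rewrite /nat_min; case: xgetP => [m _ [Sm mmin]|/(_ k)[]//].
by apply/eqP; rewrite eqn_leq mmin //= kmin.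
Qed.

(** Freeing the coordinates outside J one at a time gives a chain. *)
Lemma has_chain_coset A w J : A \in unitmx -> Gm w ->
  has_chain (coset A w J) #|~: J|.
Proof.
move=> uA gw; pose e := enum (~: J).
have se : size e = #|~: J| by rewrite -cardE.
pose F (j : nat) : {set 'I_n} := [set i : 'I_n | (j <= index i e)%N]%SET.
exists (fun j => coset A w (F j)); split=> j jd.
  split; [exact: algebraic_coset|exact: irreducible_coset|].
  move=> x [gx xF]; split=> // i iJ; apply: xF; rewrite inE.
  by rewrite memNindex ?se // mem_enum finset.in_setC negbK.
split=> [x [gx xF]|sub].
  by split=> // i; rewrite inE => /ltnW ij; apply: xF; rewrite inE.
have [i0 [ie]] : exists i0, (i0 \in e) /\ index i0 e = j.
  have i1 : 'I_n by move: jd; rewrite -se; case: (e).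
  exists (nth i1 e j); rewrite mem_nth ?se // index_uniq ?se //.
  exact: enum_uniq.
(* doubling the i0-th coordinate, which is free only in the larger coset *)
move=> ij; pose w' : point := [ffun i => if i == i0 then w i *+ 2 else w i].
have two0 : 2%:R != 0 :> K by apply: natr_neq0_char0.
have gw' : Gm w'.
  by move=> i; rewrite ffunE; case: ifP => // _; rewrite -mulr_natr mulf_neq0.
have := sub (monomap (invmx A) w'); case.
  split=> [|i]; first exact: Gm_monomap.
  rewrite inE monomapVK // ffunE; case: eqP => // ->.
  by rewrite ij ltnn.
move=> _ /(_ i0); rewrite inE ij leqnn monomapVK // ffunE eqxx => /(_ isT) /eqP.
by rewrite mulr2n -subr_eq0 addrK (negPf (gw _)).
Qed.

(** Once the coordinates in J are fixed, the characters with exponents in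
    [-B, B] are proportional to (2 B + 1)^d monomials in the d free
    coordinates, so any larger family of their combinations is dependent. *)
Lemma coset_dependence w J B m (h : 'I_m -> point -> K) :
    (forall k, regular_le B (h k)) -> (B.*2.+1 ^ #|~: J| < m)%N ->
  exists2 v : 'I_m -> K, (exists k, v k != 0) &
    forall y, Gm y -> (forall i, i \in J -> y i = w i) -> \sum_k v k * h k y = 0.
Proof.
move=> rh mB.
have [s sP] := choice (fun k => let: ex_intro2 s b e := rh k in ex_intro (fun s =>
  ebounded B s /\ forall x, Gm x -> h k x = lsum s x) s (conj b e)).
pose T := {ffun 'I_#|~: J| -> 'I_(B.*2.+1)}.
have cardT : #|{: T}| = (B.*2.+1 ^ #|~: J|)%N by rewrite card_ffun !card_ord.
pose code a : T := [ffun i => inord `|(a 0 (enum_val i) + B%:Z)%R|%N].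
pose mon (phi : T) y : K := \prod_i y (enum_val i) ^ ((phi i)%:Z - B%:Z).
pose cw a : K := \prod_(i in J) w i ^ a 0 i.
have chiE a y : (forall i, `|a 0 i| <= B%:Z) -> (forall i, i \in J -> y i = w i) ->
    chi a y = cw a * mon (code a) y.
  move=> ba yJ; rewrite /chi (bigID (mem J)) /=; congr (_ * _).
    by apply: eq_bigr => i iJ; rewrite yJ.
  rewrite (eq_bigl (fun i => i \in ~: J)); last by move=> i; rewrite inE.
  rewrite big_enum_val; apply: eq_bigr => i _; congr (_ ^ _).
  have := ba (enum_val i); rewrite ffunE; set z := a 0 _.
  by rewrite ler_norml => /andP[z1 z2]; rewrite inordK; lia.
pose M : 'M[K]_(m, #|{: T}|) := \matrix_(k, j)
  \sum_(t <- s k | code t.2 == enum_val j) t.1 * cw t.2.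
have ME k y : Gm y -> (forall i, i \in J -> y i = w i) ->
    h k y = \sum_j M k j * mon (enum_val j) y.
  move=> gy yJ; have [bs ->] := sP k; last by [].
  under eq_bigr do rewrite mxE big_distrl /= big_mkcond.
  rewrite exchange_big /=; apply: eq_big_seq => t ts.
  rewrite (bigD1 (enum_rank (code t.2))) //= enum_rankK eqxx.
  rewrite [X in _ + X]big1 ?addr0.
    by rewrite -mulrA -chiE //; apply/forallP/(allP bs).
  by move=> j /eqP jt; case: eqP => // e; case: jt; rewrite e enum_valK.
have : kermx M != 0.
  rewrite kermx_eq0 /row_free neq_ltn; apply/orP; left.
  by apply: leq_ltn_trans (rank_leq_col M) _; rewrite cardT.
move=> /rowV0Pn[v /sub_kermxP vM v0]; exists (v 0).
  have /rV0Pn := v0; case => k vk; by exists k.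
move=> y gy yJ; under eq_bigr do rewrite ME // big_distrr /=.
rewrite exchange_big big1 //= => j _.
have := congr1 (fun X : 'rV[K]_ _ => X 0 j) vM; rewrite !mxE => vMj.
by under eq_bigr do rewrite mulrA; rewrite -big_distrl /= vMj mul0r.
Qed.

(** The monomial in u 0, ..., u (j - 1) whose exponents are the base E digits
    of k; for k < E ^ j these are all the monomials with exponents below E. *)
Fixpoint digit_monomial (E : nat) (u : nat -> K) (j k : nat) : K :=
  if j is i.+1 then u i ^+ (k %/ E ^ i) * digit_monomial E u i (k %% E ^ i)
  else 1.

Lemma sum_digit_monomialS E u j (v : nat -> K) : (0 < E)%N ->
  \sum_(k < E ^ j.+1) v k * digit_monomial E u j.+1 k =
  \sum_(q < E) u j ^+ q *
    \sum_(r < E ^ j) v (q * E ^ j + r)%N * digit_monomial E u j r.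
Proof.
move=> E0; suff gen N : \sum_(k < N * E ^ j) v k * digit_monomial E u j.+1 k =
    \sum_(q < N) u j ^+ q *
      \sum_(r < E ^ j) v (q * E ^ j + r)%N * digit_monomial E u j r.
  by rewrite expnS gen.
elim: N => [|N IH]; first by rewrite mul0n !big_ord0.
rewrite mulSn addnC big_split_ord /= IH big_ord_recr /=; congr (_ + _).
rewrite big_distrr /=; apply: eq_bigr => r _.
have Ej : (0 < E ^ j)%N by rewrite expn_gt0 E0.
rewrite divnMDl // divn_small // addn0 modnMDl modn_small //.
by rewrite mulrCA.
Qed.

Lemma digit_monomial_regular E B (f : nat -> point -> K) j k : (0 < E)%N ->
    (forall i, (i < j)%N -> regular_le B (f i)) -> (k < E ^ j)%N ->
  regular_le (j * (E * B)) (fun x => digit_monomial E (f^~ x) j k).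
Proof.
move=> E0; elim: j k => [|j IH] k rf kE /=; first exact: regular_le_cst.
have Ej : (0 < E ^ j)%N by rewrite expn_gt0 E0.
rewrite mulSn; apply: regular_leM.
  apply: regular_leS (regular_leX _ (rf j (ltnSn j))).
  by rewrite leq_mul2r ltnW ?orbT // ltn_divLR // -expnS.
by apply: IH => [i ij|]; [apply/rf/ltnW|rewrite ltn_mod].
Qed.

(** A relation between f 0, ..., f j on Z (j + 1) can be divided by the largest
    power of f j in it, because Z (j + 1) is irreducible and f j does not vanish
    on it; restricting to Z j, where f j is zero, leaves a nontrivial relation
    between f 0, ..., f (j - 1). *)
Lemma chain_independent E D (Z : nat -> set point) (f : nat -> point -> K) :
    (0 < E)%N -> (forall j, (j <= D)%N -> Z j `<=` @Gm K n /\ zirreducible (Z j)) ->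
    (forall j, (j < D)%N -> Z j `<=` Z j.+1) -> (forall j, regular (f j)) ->
    (forall j, (j < D)%N -> forall x, Z j x -> f j x = 0) ->
    (forall j, (j < D)%N -> exists2 x, Z j.+1 x & f j x != 0) ->
  forall j, (j <= D)%N -> forall v : nat -> K,
    (forall x, Z j x -> \sum_(k < E ^ j) v k * digit_monomial E (f^~ x) j k = 0) ->
  forall k, (k < E ^ j)%N -> v k = 0.
Proof.
move=> E0 Zirr Zsub rf fZ fZn; elim=> [|j IH] jD v vZ k kE.
  have [_ [[x Zx] _]] := Zirr 0%N jD; have := vZ x Zx.
  by rewrite big_ord1 mulr1; move: kE; rewrite ltnS leqn0 => /eqP ->.
have Ej : (0 < E ^ j)%N by rewrite expn_gt0 E0.
pose P (q : nat) x := \sum_(r < E ^ j) v (q * E ^ j + r)%N * digit_monomial E (f^~ x) j r.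
suff zero (q : nat) : (q < E)%N -> forall r, (r < E ^ j)%N -> v (q * E ^ j + r)%N = 0.
  rewrite (divn_eq k (E ^ j)); apply: zero; last by rewrite ltn_mod.
  by rewrite ltn_divLR // -expnS.
elim/ltn_ind: q => q IHq qE; apply: IH => [|x Zx]; first exact: ltnW.
have P0 (q' : nat) x' : (q' < q)%N -> P q' x' = 0.
  move=> q'q; rewrite /P big1 // => r _; rewrite IHq ?mul0r //.
  exact: ltn_trans q'q qE.
have rP (q' : nat) : regular (P q').
  apply: regular_sum => r; apply: regularM; first exact: regular_cst.
  have /choice[b bP] i : exists b, regular_le b (f i) by apply: regular_bounded.
  apply: regular_leW (@digit_monomial_regular E (\max_(i < j) b i) f j r E0 _ _) => //.
  by move=> i ij; apply: regular_leS (bP i); apply: (leq_bigmax (Ordinal ij)).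
pose W x := \sum_(i < E - q) f j x ^+ i * P (q + i)%N x.
have rW : regular W.
  by apply: regular_sum => i; apply: regularM; [exact: regularX|exact: rP].
have [ZG Zi] := Zirr _ jD.
have fW x' : Z j.+1 x' -> f j x' ^+ q * W x' = 0.
  move=> Zx'; rewrite -[RHS](vZ x' Zx') sum_digit_monomialS //.
  rewrite -(big_mkord xpredT (fun i => f j x' ^+ i * P i x')).
  rewrite (big_cat_nat (n := q)) //=; last exact: ltnW.
  rewrite big_nat big1 ?add0r; last by move=> i /andP[_ iq]; rewrite P0 ?mulr0.
  rewrite -{2}[q]add0n big_addn big_mkord big_distrr /=.
  by apply: eq_bigr => i _; rewrite mulrA -exprD addnC.
have [H|H] := irreducible_mul_eq0 ZG Zi (regularX q (rf j)) rW fW.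
  have [x' Zx' /negP[]] := fZn j jD; have /eqP := H x' Zx'.
  by rewrite expf_eq0 => /andP[].
have := H x (Zsub _ jD _ Zx); rewrite /W.
have Eq : (0 < E - q)%N by rewrite subn_gt0.
rewrite -(prednK Eq) big_ord_recl expr0 mul1r addn0 big1 ?addr0 // => i _.
by rewrite fZ // expr0n mul0r.
Qed.

(** A chain of length D yields E^D independent monomials of exponents less
    than E, and their own exponents are O(E); so E^D = O(E^d) as E grows. *)
Lemma chain_length_coset A w J D : A \in unitmx ->
  has_chain (coset A w J) D -> (D <= #|~: J|)%N.
Proof.
move=> uA [Z [Zp Zlt]]; rewrite leqNgt; apply/negP => dD.
set d := #|_| in dD.
have Zirr j : (j <= D)%N -> Z j `<=` @Gm K n /\ zirreducible (Z j).
  by move=> /Zp[_ ? ZS]; split=> //; apply: subset_trans ZS (@coset_sub_Gm A w J).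
have /choice[f fP] j : exists f : point -> K, regular f /\ ((j < D)%N ->
    (forall x, Z j x -> f x = 0) /\ exists2 x, Z j.+1 x & f x != 0).
  have [jD|_] := ltnP j D; last by exists (fun=> 0); split; first exact: regular_cst.
  have [_ /existsNP[x /not_implyP[Zx nZx]]] := Zlt j jD.
  have [algZ _ _] := Zp j (ltnW jD).
  have [f [rf fZ fx]] := algebraic_sep algZ ((Zirr _ jD).1 x Zx) nZx.
  by exists f; split=> // _; split=> //; exists x.
pose f' j y := f j (monomap (invmx A) y).
have /choice[b bP] j : exists B, regular_le B (f' j).
  by apply: regular_bounded; apply: regular_monomap; have [] := fP j.
pose B := (\max_(i < D) b i)%N.
(* (2 D E B + 1)^d <= (E c)^d = E^d (E - 1) < E^(d + 1) <= E^D *)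
pose c := (D * B).*2.+1; pose E := (c ^ d).+1.
have rmon (k : 'I_(E ^ D)) :
    regular_le (D * (E * B)) (fun x => digit_monomial E (f'^~ x) D k).
  apply: digit_monomial_regular => // i iD.
  by apply: regular_leS (bP i); apply: (leq_bigmax (Ordinal iD)).
have [|v [k vk] vS] := @coset_dependence w J _ _ _ rmon.
  rewrite -/d; apply: (@leq_ltn_trans ((E * c) ^ d)).
    have [->|d0] := posnP d; first by rewrite !expn0.
    by rewrite leq_exp2r // /c; nia.
  apply: (@leq_trans (E ^ d.+1)); last by rewrite leq_pexp2l.
  by rewrite expnMn expnSr ltn_pmul2l ?expn_gt0.
have := @chain_independent E D Z f isT Zirr (fun j jD => (Zlt j jD).1)
  (fun j => (fP j).1) (fun j jD => ((fP j).2 jD).1) (fun j jD => ((fP j).2 jD).2)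
  D (leqnn D) (fun i => if insub i is Some k then v k else 0).
move=> /(_ _ k (ltn_ord k)); rewrite valK => H; move/eqP: vk; apply; apply: H.
move=> x Zx; have [_ _ /(_ x Zx) [gx xJ]] := Zp D (leqnn D).
rewrite -[RHS](vS (monomap A x)) //; last exact: Gm_monomap.
by apply: eq_bigr => i _; rewrite valK /f' monomapK.
Qed.

Lemma krull_dim_coset A w J : A \in unitmx -> Gm w ->
  krull_dim (coset A w J) = #|~: J|.
Proof.
move=> uA gw; apply: nat_maxE; first exact: has_chain_coset.
by move=> j; apply: chain_length_coset.
Qed.

End CosetGeometry.

(** * Torsion points of cosets *)

Section TorsionOrder.
Variables (K : fieldType) (n : nat).
Notation point := {ffun 'I_n -> K}.
Implicit Types (x w : point) (A : 'M[int]_n).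

Lemma tors_ord_dvd x k : torsion x -> (tors_ord x %| k)%N = (x ^+ k == 1).
Proof.
move=> tx; have [pos xord] := tors_ordP tx; apply/idP/eqP => [/dvdnP[q ->]|xk].
  by rewrite mulnC exprM xord expr1n.
have : x ^+ (k %% tors_ord x) = 1.
  by rewrite -xk [in RHS](divn_eq k (tors_ord x)) exprD mulnC exprM xord expr1n mul1r.
have rlt := ltn_pmod k pos; move=> xr; rewrite /dvdn; move: (k %% _)%N rlt xr => r rlt xr.
apply: contraTT rlt; rewrite -lt0n -leqNgt => r0.
rewrite /tors_ord /nat_min; case: xgetP => [m _ [_ mmin]|//].
by apply: mmin.
Qed.

Lemma torsion_expr x k : (0 < k)%N -> x ^+ k = 1 -> torsion x.
Proof.
move=> k0 xk; split; last by exists k.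
move=> i; have := congr1 (fun u : point => u i) xk.
rewrite ffun_expE ffunE => /eqP; apply: contraTneq => ->.
by rewrite expr0n eqn0Ngt k0 eq_sym oner_neq0.
Qed.

Lemma tors_ord_monomap A x : A \in unitmx -> Gm x ->
  tors_ord (monomap A x) = tors_ord x.
Proof.
move=> uA gx; congr nat_min; apply/seteqP; split=> k [k0 xk]; split=> //.
- exact: (iffLR (monomap_expr_eq1 k uA gx)).
- exact: (iffRL (monomap_expr_eq1 k uA gx)).
Qed.

(** If N kills a point of the coset then it kills the fixed coordinates, which
    are those of w; conversely w itself, in the coordinates given by A, is a
    point of the coset. *)
Lemma coset_ord_coset A w (J : {set 'I_n}) : A \in unitmx -> torsion w ->
  (forall i, i \notin J -> w i = 1) -> coset_ord (coset A w J) = tors_ord w.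
Proof.
move=> uA tw w1; have [gw _] := tw; apply: nat_minE.
  have gv : Gm (monomap (invmx A) w) by apply: Gm_monomap.
  exists (monomap (invmx A) w); last by rewrite tors_ord_monomap // unitmx_inv.
  split; last exact: torsion_monomap.
  by split=> // i _; rewrite monomapVK.
move=> _ [x [[gx xJ] tx] <-]; have [pos xord] := tors_ordP tx.
apply: dvdn_leq => //; rewrite tors_ord_dvd //; apply/eqP/ffunP => i.
rewrite ffun_expE [RHS]ffunE; have [iJ|/w1 ->] := boolP (i \in J); last exact: expr1n.
by rewrite -xJ // -ffun_expE -monomapX xord monomap1 ffunE.
Qed.

Definition count_killed (X : set point) (N : nat) : nat :=
  #|` fset_set [set x | X x /\ x ^+ N = 1]|.

Lemma count_killed_seq (X : set point) N (s : seq point) : uniq s ->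
  (forall x, x \in s <-> X x /\ x ^+ N = 1) -> count_killed X N = size s.
Proof.
move=> us sP; rewrite /count_killed.
have -> : [set x | X x /\ x ^+ N = 1] = [set` seq_fset tt s].
  apply/seteqP; split=> x H; last by apply/sP; rewrite -(seq_fsetE tt).
  by change (x \in seq_fset tt s); rewrite seq_fsetE; apply/sP.
by rewrite set_fsetK size_seq_fset undup_id.
Qed.

End TorsionOrder.

Lemma leq_size_fibers (T U : eqType) (f : T -> U) (s : seq T) (t : seq U) c :
  (forall x, x \in s -> f x \in t) ->
  (forall b, b \in t -> (size [seq x <- s | f x == b] <= c)%N) ->
  (size s <= c * size t)%N.
Proof.
move=> fs fib; apply: (@leq_trans (\sum_(x <- s) \sum_(b <- t) (f x == b))).
  rewrite -sum1_size big_seq [X in (_ <= X)%N]big_seq leq_sum // => x xs.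
  by rewrite (big_rem _ (fs x xs)) /= eqxx.
rewrite exchange_big /= mulnC -sum1_size big_distrl /=.
rewrite big_seq [X in (_ <= X)%N]big_seq leq_sum // => b bt.
rewrite mul1n (leq_trans _ (fib b bt)) // size_filter -sum1_count [X in (_ <= X)%N]big_mkcond.
by apply: leq_sum => x _; case: (f x == b).
Qed.

Section TorsionCount.
Variables (K : closedFieldType) (n : nat).
Hypothesis K_char0 : [pchar K] =i pred0.
Notation point := {ffun 'I_n -> K}.
Implicit Types (x w : point) (A : 'M[int]_n) (J : {set 'I_n}).

Lemma roots_of_unity N : (0 < N)%N ->
  exists2 rs : N.-tuple K, uniq rs & forall z, (z \in rs) = (z ^+ N == 1).
Proof.
move=> N0; have [rs E] := closed_field_poly_normal ('X^N - 1 : {poly K}).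
have lc : lead_coef ('X^N - 1 : {poly K}) = 1.
  by apply/eqP; apply: monicXnsubC.
rewrite lc scale1r in E.
have srs : size rs == N.
  have := size_prod_XsubC rs id; rewrite -E size_XnsubC // => -[->]; exact: eqxx.
exists (Tuple srs) => /=.
  rewrite -separable_prod_XsubC -E; apply: separable_Xn_sub_1.
  exact: natr_neq0_char0.
move=> z; change ((z \in rs) = (z ^+ N == 1)).
by rewrite -root_prod_XsubC -E /root !hornerE subr_eq0.
Qed.

(** In the coordinates given by A, the points killed by N have N-th roots of
    unity as coordinates; there are N of these, since K is algebraically closed
    of characteristic zero. *)
Lemma coset_killed_seq A w J N : (0 < N)%N -> A \in unitmx -> torsion w ->
    (forall i, i \notin J -> w i = 1) ->
  exists s : seq point, [/\ uniq s, forall x, x \in s <-> coset A w J x /\ x ^+ N = 1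
    & size s = if (tors_ord w %| N)%N then (N ^ #|~: J|)%N else 0%N].
Proof.
move=> N0 uA tw w1; have [gw _] := tw; rewrite tors_ord_dvd //.
case: eqP => [wN|wN]; last first.
  exists [::]; split=> // x; split=> // -[[gx xJ] xN]; case: wN.
  apply/ffunP => i; rewrite ffun_expE [RHS]ffunE.
  have [iJ|/w1 ->] := boolP (i \in J); last exact: expr1n.
  by rewrite -xJ // -ffun_expE -monomapX xN monomap1 ffunE.
have [rs urs rsP] := roots_of_unity N0.
pose F (i : 'I_n) : pred 'I_N :=
  [pred k | (i \in J) ==> (tnth rs k == w i)].
pose y (phi : {ffun 'I_n -> 'I_N}) : point := [ffun i => tnth rs (phi i)].
have yN phi : y phi ^+ N = 1.
  by apply/ffunP => i; rewrite ffun_expE !ffunE; apply/eqP; rewrite -rsP mem_tnth.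
have gy phi : Gm (y phi) by have [] := torsion_expr N0 (yN phi).
have yinj : injective y.
  move=> phi psi /ffunP e; apply/ffunP => i; have := e i; rewrite !ffunE => /eqP.
  by rewrite (inj_eq (tuple_uniqP _ urs)) => /eqP.
exists [seq monomap (invmx A) (y phi) | phi <- enum (family F)]; split.
- rewrite map_inj_uniq ?enum_uniq // => phi psi /(congr1 (monomap A)).
  by rewrite !monomapVK // => /yinj.
- move=> x; split.
    move=> /mapP[phi]; rewrite mem_enum => /familyP phiF ->.
    split; last by rewrite -monomapX yN monomap1.
    split=> [|i iJ]; first exact: Gm_monomap.
    rewrite monomapVK // ffunE; apply/eqP.
    by have := phiF i; rewrite inE /= iJ.
  move=> [[gx xJ] xN].
  have mx i : monomap A x i \in rs.
    by rewrite rsP -ffun_expE -monomapX xN monomap1 ffunE.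
  have ix i : (index (monomap A x i) rs < N)%N.
    by have := mx i; rewrite -index_mem size_tuple.
  pose phi : {ffun 'I_n -> 'I_N} := [ffun i => Ordinal (ix i)].
  have yphi : y phi = monomap A x.
    by apply/ffunP => i; rewrite !ffunE (tnth_nth 0) /= nth_index.
  apply/mapP; exists phi; last by rewrite yphi monomapK.
  rewrite mem_enum; apply/familyP => i; rewrite inE; apply/implyP => iJ.
  by rewrite -xJ // -yphi [X in _ == X]ffunE.
rewrite size_map -cardE card_family foldrE big_map big_enum /=.
rewrite (bigID (mem J)) /= big1 ?mul1n; last first.
  move=> i iJ; have : w i \in rs by rewrite rsP -ffun_expE wN ffunE.
  move=> /tnthP[k wk]; rewrite (@eq_card _ _ (pred1 k)) ?card1 // => j.
  by rewrite !inE iJ /= wk (inj_eq (tuple_uniqP _ urs)).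
rewrite (eq_bigr (fun=> N)); last first.
  move=> i iJ; rewrite -[RHS]card_ord; apply: eq_card => j.
  by rewrite !inE (negPf iJ).
rewrite prod_nat_const; congr expn; apply: eq_card => i.
by rewrite !inE.
Qed.

Lemma count_killed_coset A w J N : (0 < N)%N -> A \in unitmx -> torsion w ->
    (forall i, i \notin J -> w i = 1) ->
  count_killed (coset A w J) N = if (tors_ord w %| N)%N then (N ^ #|~: J|)%N else 0%N.
Proof.
move=> N0 uA tw w1; have [s [us sP <-]] := coset_killed_seq N0 uA tw w1.
exact: count_killed_seq.
Qed.

Lemma finite_killed (X : set point) N : (0 < N)%N ->
  finite_set [set x | X x /\ x ^+ N = 1].
Proof.
move=> N0; have t1 : torsion (1 : point).
  by split; [exact: Gm1|exists 1%N; rewrite ?expr1].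
have w1 i : i \notin finset.set0 -> (1 : point) i = 1 by rewrite ffunE.
have [s [us sP _]] := coset_killed_seq N0 (unitmx1 _ _) t1 w1.
apply: (sub_finite_set _ (finite_seq s)) => x [_ xN] /=.
apply/sP; split=> //; split=> [|i]; last by rewrite inE.
by have [] := torsion_expr N0 xN.
Qed.

Lemma count_killed_enum (X : set point) N : (0 < N)%N ->
  exists s : seq point, [/\ uniq s, forall x, x \in s <-> X x /\ x ^+ N = 1
    & size s = count_killed X N].
Proof.
move=> N0; have fin := finite_killed X N0.
exists (fset_set [set x | X x /\ x ^+ N = 1]); split=> //; first exact: fset_uniq.
by move=> x; rewrite in_fset_set //; split; rewrite inE.
Qed.

(** When the coset C is not contained in the coset C', some character is
    constant on C' but not equal to that constant on C.  On C it is a monomial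
    in the free coordinates; if one of these occurs in it with exponent b,
    then a torsion point of C in C' is determined by its other free
    coordinates up to |b| choices. *)
Lemma count_killed_proper_coset A w J A' w' J' :
    A \in unitmx -> torsion w -> (forall i, i \notin J -> w i = 1) ->
    ~ (coset A w J `<=` coset A' w' J') ->
  exists c, forall N, (0 < N)%N ->
    (count_killed (coset A w J `&` coset A' w' J') N <= c * N ^ #|~: J|.-1)%N.
Proof.
move=> uA tw w1 /existsNP[x0 /not_implyP[[gx0 x0J] nx0]].
have [gw _] := tw.
have {nx0} [i0 [i0J ni0]] : exists i0, i0 \in J' /\ monomap A' x0 i0 <> w' i0.
  apply: contrapT => /forallNP H; apply: nx0; split=> // i iJ.
  by apply: contrapT => ne; apply: (H i).
pose b := row i0 A' *m invmx A.
have chib x : Gm x -> monomap A' x i0 = chi b (monomap A x).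
  by move=> gx; rewrite chi_monomap // mulmxKV // ffunE.
have [[k [kJ bk]]|nob] := pselect (exists k, k \notin J /\ b 0 k != 0); last first.
  (* the character is constant on C, so that C and C' are disjoint *)
  exists 0%N => N N0.
  have [s [_ sP <-]] := count_killed_enum (coset A w J `&` coset A' w' J') N0.
  rewrite mul0n leqn0; case: s sP => // x s sP.
  have [[[gx xJ] [_ xJ']] _] := (iffLR (sP x)) (mem_head _ _).
  case: ni0; rewrite -(xJ' i0) // !chib //; apply: eq_bigr => k _.
  have [kJ|kJ] := boolP (k \in J); first by rewrite x0J // xJ.
  have -> : b 0 k = 0 by apply/eqP/negbNE/negP => bk; apply: nob; exists k.
  by rewrite !expr0z.
exists `|b 0%R k|%N => N N0.
have [s [us sP <-]] := count_killed_enum (coset A w J `&` coset A' w' J') N0.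
have w1' i : i \notin k |: J -> w i = 1.
  by rewrite !inE negb_or => /andP[_ /w1].
have [t [ut tP st]] := coset_killed_seq N0 uA tw w1'.
(* forget the coordinate k; the result lies in a coset of smaller dimension *)
pose trunc x : point := [ffun i => if i == k then 1 else monomap A x i].
pose f x := monomap (invmx A) (trunc x).
have Gtrunc x : Gm x -> Gm (trunc x).
  move=> gx i; rewrite ffunE; case: ifP => _; first exact: oner_neq0.
  exact: Gm_monomap.
apply: (@leq_trans (`|b 0%R k| * size t)); last first.
  rewrite leq_mul2l st; case: ifP => _; rewrite ?leq0n ?orbT //.
  rewrite (cardsD1 k (~: J)) inE kJ /= (_ : ~: J :\ k = ~: (k |: J)) ?leqnn ?orbT //.
  by apply/setP => i; rewrite !inE negb_or.
apply: (leq_size_fibers (f := f)) => [x /sP[[[gx xJ] _] xN]|v _].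
  apply/tP; split; last first.
    rewrite -monomapX (_ : trunc x ^+ N = 1) ?monomap1 //.
    apply/ffunP => i; rewrite ffun_expE !ffunE; case: ifP; rewrite ?expr1n // => _.
    by rewrite -chiX xN chi1.
  split=> [|i]; first exact/Gm_monomap/Gtrunc.
  rewrite monomapVK //; last exact: Gtrunc.
  rewrite 2!inE ffunE; case: eqP => [-> _|_ /= iJ]; first by rewrite w1.
  exact: xJ.
set r := [seq x <- s | f x == v].
have rP x : x \in r -> [/\ Gm x, chi b (monomap A x) = w' i0 & trunc x = monomap A v].
  rewrite mem_filter => /andP[/eqP fx /sP[[[gx xJ] [_ xJ']] xN]]; split=> //.
    by rewrite -chib // xJ'.
  by rewrite -fx /f monomapVK //; apply: Gtrunc.
have off x i : x \in r -> i != k -> monomap A x i = monomap A v i.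
  by move=> /rP[_ _ <-] ik; rewrite [RHS]ffunE (negPf ik).
have [->//|[x1 x1r]] : r = [::] \/ exists x1, x1 \in r.
  by case: (r) => [|x1 r']; [left|right; exists x1; rewrite mem_head].
have pow x : x \in r ->
    monomap A x k ^+ `|b 0%R k| = monomap A x1 k ^+ `|b 0%R k|.
  move=> xr; have [gx xb _] := rP x xr; have [gx1 x1b _] := rP x1 x1r.
  have : monomap A x k ^ b 0 k = monomap A x1 k ^ b 0 k.
    have := etrans xb (esym x1b); rewrite /chi (bigD1 k) //= [in RHS](bigD1 k) //=.
    rewrite (eq_bigr (fun i => monomap A x1 i ^ b 0 i)); last first.
      by move=> i ik; rewrite !off.
    apply: mulIf; apply/prodf_neq0 => i _; rewrite expfz_neq0 //.
    exact: Gm_monomap.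
  by case: (b 0 k) => [j|j] //= /invr_inj.
pose P : {poly K} := 'X^`|b 0%R k| - (monomap A x1 k ^+ `|b 0%R k|)%:P.
have b0 : (0 < `|b 0%R k|)%N by rewrite absz_gt0.
have sP' : size P = `|b 0%R k|.+1 by rewrite size_XnsubC.
have P0 : P != 0 by rewrite -size_poly_eq0 sP'.
have := @max_poly_roots _ P [seq monomap A x k | x <- r] P0.
rewrite sP' size_map ltnS; apply.
  apply/allP => _ /mapP[x xr ->].
  by rewrite /root !hornerE pow // subrr.
rewrite map_inj_in_uniq ?filter_uniq // => x x' xr xr' xk.
have [gx _ _] := rP x xr; have [gx' _ _] := rP x' xr'.
rewrite -(monomapK uA gx) -(monomapK uA gx'); congr monomap; apply/ffunP => i.
by have [->//|ik] := eqVneq i k; rewrite !off.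
Qed.

End TorsionCount.

(** * Moebius inversion *)

Section Moebius.
Variable R : realType.
Implicit Types (m n k j p d N : nat).

Definition moebius m : R :=
  \prod_(p <- primes m) (if (logn p m == 1)%N then -1 else 0).

Lemma moebius1 : moebius 1 = 1.
Proof. by rewrite /moebius big_nil. Qed.

Lemma normr_moebius_le1 m : `|moebius m| <= 1.
Proof.
rewrite /moebius normr_prod; apply: prodr_ile1 => p _.
by rewrite normr_ge0 /=; case: ifP; rewrite ?normrN ?normr1 ?normr0 ?ler01.
Qed.

Lemma moebius_mul_prime p d : prime p -> (0 < d)%N ->
  moebius (p * d) = if (p %| d)%N then 0 else - moebius d.
Proof.
move=> pp d0; have p0 := prime_gt0 pp.
have [pd|pd] := boolP (p %| d)%N.
  have pin : p \in primes (p * d) by rewrite mem_primes pp muln_gt0 p0 d0 dvdn_mulr.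
  rewrite /moebius (big_rem _ pin) /= lognM // logn_prime // eqxx.
  have : (0 < logn p d)%N by rewrite logn_gt0 mem_primes pp d0.
  by case: (logn p d) => //= e _; rewrite mul0r.
have pnin : p \notin primes d by rewrite mem_primes pp d0 (negPf pd).
have perm : perm_eq (primes (p * d)) (p :: primes d).
  apply: uniq_perm; rewrite ?primes_uniq //= ?pnin ?primes_uniq // => q.
  by rewrite primesM // primes_prime // !inE.
rewrite /moebius (perm_big _ perm) big_cons lognM // logn_prime // eqxx.
rewrite (lognE p d) pp d0 (negPf pd) /= mulN1r; congr (- _).
apply: eq_big_seq => q qd; rewrite lognM // logn_prime //.
have -> : (q == p) = false by apply: contraNF pnin => /eqP <-.
by [].
Qed.

(** The divisors of m divisible by a prime p are the p d with d dividing m/p;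
    those d that are prime to p cancel against the divisors of m that are
    prime to p, and the others contribute nothing. *)
Lemma sum_moebius_divisors m : (0 < m)%N ->
  \sum_(d <- divisors m) moebius d = (m == 1)%:R.
Proof.
move=> m0; have [->|m1] := eqVneq m 1%N.
  by rewrite (_ : divisors 1 = [:: 1%N]) // big_seq1 moebius1.
have m_gt1 : (1 < m)%N by rewrite ltn_neqAle eq_sym m1.
have pp := pdiv_prime m_gt1; set p := pdiv m in pp.
have p0 := prime_gt0 pp.
have [q mq] : exists q, m = (p * q)%N.
  by have /dvdnP[q mq] := pdiv_dvd m; exists q; rewrite mulnC.
have q0 : (0 < q)%N by move: m0; rewrite mq muln_gt0 => /andP[].
rewrite (bigID (fun d => p %| d)%N) /= -big_filter -[X in _ + X]big_filter.
have permp : perm_eq [seq d <- divisors m | (p %| d)%N] [seq (p * d)%N | d <- divisors q].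
  apply: uniq_perm; first by rewrite filter_uniq ?divisors_uniq.
    rewrite map_inj_uniq ?divisors_uniq // => x y /eqP.
    by rewrite eqn_pmul2l // => /eqP.
  move=> d; rewrite mem_filter -dvdn_divisors // mq.
  apply/andP/mapP => [[/dvdnP[e ->]]|[e]].
    by rewrite mulnC dvdn_pmul2l // => eq; exists e; rewrite // -dvdn_divisors.
  by rewrite -dvdn_divisors // => eq ->; rewrite dvdn_mulr // dvdn_pmul2l.
have permq : perm_eq [seq d <- divisors m | ~~ (p %| d)%N] [seq d <- divisors q | ~~ (p %| d)%N].
  apply: uniq_perm; rewrite ?filter_uniq ?divisors_uniq // => d.
  rewrite !mem_filter -!dvdn_divisors // mq; have [//|pd] := boolP (p %| d)%N.
  by rewrite /= Gauss_dvdr // coprime_sym prime_coprime.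
rewrite (perm_big _ permp) (perm_big _ permq) big_map big_filter /=.
rewrite [X in _ + X]big_mkcond -big_split big_seq big1 //= => d.
rewrite -dvdn_divisors // => dq; rewrite moebius_mul_prime ?(dvdn_gt0 q0) //.
by case: ifP => _; rewrite ?addr0 ?addNr.
Qed.

Lemma sum_multiples (V : nmodType) k N (G : nat -> V) : (0 < k)%N ->
  \sum_(1 <= m < N.+1 | (k %| m)%N) G m = \sum_(1 <= j < (N %/ k).+1) G (k * j)%N.
Proof.
move=> k0; elim: N => [|N IH]; first by rewrite div0n !big_geq.
rewrite big_mkcond big_nat_recr //= -big_mkcond IH divnS //.
have [kN|] := boolP (k %| N.+1)%N; last by rewrite addr0 add0n.
have e : N.+1 = (k * (N %/ k).+1)%N.
  by rewrite -[LHS](divnK kN) divnS // kN mulnC.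
by rewrite [in RHS]big_nat_recr //= -e.
Qed.

Lemma moebius_sum N (F : nat -> R) : (0 < N)%N ->
  \sum_(1 <= k < N.+1) \sum_(1 <= j < (N %/ k).+1) moebius k * F (k * j)%N = F 1%N.
Proof.
move=> N0.
transitivity (\sum_(1 <= k < N.+1) \sum_(1 <= m < N.+1)
    (if (k %| m)%N then moebius k * F m else 0)).
  apply: eq_big_nat => k /andP[k0 _].
  by rewrite -(sum_multiples N (fun m => moebius k * F m)) // big_mkcond.
rewrite exchange_big /=.
transitivity (\sum_(1 <= m < N.+1) (m == 1)%:R * F m).
  apply: eq_big_nat => m /andP[m0 mN].
  rewrite -sum_moebius_divisors // big_distrl /= -big_mkcond -big_filter.
  apply: perm_big; apply: uniq_perm; rewrite ?filter_uniq ?iota_uniq ?divisors_uniq //.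
  move=> d; rewrite mem_filter mem_index_iota -dvdn_divisors //.
  have [dm|] := boolP (d %| m)%N => //=.
  by rewrite (dvdn_gt0 m0 dm) (leq_ltn_trans (dvdn_leq m0 dm)).
rewrite big_ltn // eqxx mul1r big_nat big1 ?addr0 // => m /andP[m1 _].
by rewrite gtn_eqF // mul0r.
Qed.

Lemma sum_divn_truncate t N (g G : nat -> R) : G 0%N = 0 -> (N <= t)%N ->
  \sum_(1 <= k < t.+1) g k * G (N %/ k)%N = \sum_(1 <= k < N.+1) g k * G (N %/ k)%N.
Proof.
move=> G0 Nt; rewrite (big_cat_nat (n := N.+1)) //= [X in _ + X]big_nat.
rewrite [X in _ + X]big1 ?addr0 // => k /andP[Nk _].
by rewrite divn_small // G0 mulr0.
Qed.

Lemma moebius_sum_divn t N : (0 < N <= t)%N ->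
  \sum_(1 <= k < t.+1) moebius k * (N %/ k)%:R = 1.
Proof.
move=> /andP[N0 Nt]; rewrite (sum_divn_truncate _ (G := fun m => m%:R)) //.
rewrite -[RHS](@moebius_sum N (fun=> 1)) //; apply: eq_bigr => k _.
by rewrite mulr1 sumr_const_nat subn1 /= mulr_natr.
Qed.

End Moebius.

(** * Summatory function of the Jordan totient *)

Section Analytic.
Variable R : realType.
Implicit Types (m k j d N : nat) (x y T : R).

Lemma exprB_bounds x y d : 0 <= y <= x ->
  d.+1%:R * y ^+ d * (x - y) <= x ^+ d.+1 - y ^+ d.+1 <= d.+1%:R * x ^+ d * (x - y).
Proof.
move=> /andP[y0 yx]; have x0 := le_trans y0 yx.
rewrite subrXX [_ * (\sum_(_ < _) _)]mulrC !ler_wpM2r ?subr_ge0 //.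
  rewrite mulr_natl -[X in _ *+ X]card_ord -sumr_const.
  apply: ler_sum => i _; have id : (i <= d)%N by rewrite -ltnS.
  by rewrite -[in leRHS](subnK id) exprD /= ler_pM ?exprn_ge0 // lerXn2r.
rewrite mulr_natl -[X in _ *+ X]card_ord -sumr_const.
apply: ler_sum => i _; have id : (i <= d)%N by rewrite -ltnS.
by rewrite -[in leLHS](subnK id) exprD /= ler_pM ?exprn_ge0 // lerXn2r.
Qed.

Definition powsum d m : R := \sum_(1 <= j < m.+1) j%:R ^+ d.

Lemma powsum_bounds d m :
  m%:R ^+ d.+1 <= d.+1%:R * powsum d m <= m%:R ^+ d.+1 + d.+1%:R * m%:R ^+ d.
Proof.
elim: m => [|m /andP[IH1 IH2]].
  by rewrite /powsum big_geq // mulr0 expr0n lexx add0r mulr_ge0 ?exprn_ge0.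
have le : 0 <= (m%:R : R) <= m.+1%:R by rewrite ler0n ler_nat /=.
have := exprB_bounds d le; rewrite -natrB // subSnn !mulr1 => /andP[D1 D2].
rewrite /powsum big_nat_recr //= -/(powsum d m) mulrDr.
by apply/andP; split; lra.
Qed.

Lemma powsum_approx d m y : m%:R <= y < m.+1%:R ->
  `|d.+1%:R * powsum d m - y ^+ d.+1| <= d.+1%:R * y ^+ d.
Proof.
move=> /andP[my ym]; have m0 : 0 <= m%:R :> R by [].
have y0 : 0 <= y by apply: le_trans my.
have /andP[P1 P2] := powsum_bounds d m.
have := @exprB_bounds y m%:R d; rewrite m0 my => /(_ isT) /andP[D1 D2].
have md : m%:R ^+ d <= y ^+ d by rewrite lerXn2r.
have c0 : 0 <= d.+1%:R * y ^+ d by rewrite mulr_ge0 ?exprn_ge0.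
have c1 : d.+1%:R * m%:R ^+ d <= d.+1%:R * y ^+ d by rewrite ler_wpM2l.
have c2 : d.+1%:R * m%:R ^+ d * (y - m%:R) >= 0.
  by rewrite !mulr_ge0 ?exprn_ge0 ?subr_ge0.
have c3 : d.+1%:R * y ^+ d * (y - m%:R) <= d.+1%:R * y ^+ d.
  by rewrite ler_piMr // lerBlDr addrC natr1 ltW.
by rewrite ler_norml; apply/andP; split; lra.
Qed.

Definition zeta_sum d m : R := \sum_(1 <= j < m.+1) (j%:R ^+ d.+1)^-1.

Lemma zeta_sumS d m : zeta_sum d m.+1 = zeta_sum d m + (m.+1%:R ^+ d.+1)^-1.
Proof. by rewrite /zeta_sum big_nat_recr. Qed.

Lemma zeta_sum_homo d : {homo zeta_sum d : m N / (m <= N)%N >-> m <= N}.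
Proof.
apply: homo_leq => [//|m N k|m]; first exact: le_trans.
by rewrite zeta_sumS lerDl invr_ge0 exprn_ge0.
Qed.

(** Comparison with the telescoping series of 1/j - 1/(j+1). *)
Lemma zeta_sum_tail d m N : (m <= N)%N ->
  zeta_sum d.+1 N <= zeta_sum d.+1 m + 2 * (m.+1%:R ^+ d.+1)^-1.
Proof.
rewrite leq_eqVlt => /predU1P[->|].
  by rewrite lerDl mulr_ge0 // invr_ge0 exprn_ge0.
move=> /subnKC <-; move: (N - m.+1)%N => i {N}.
suff : zeta_sum d.+1 (m.+1 + i) <=
    zeta_sum d.+1 m + (m.+1%:R ^+ d)^-1 * (2 * m.+1%:R^-1 - (m.+1 + i)%:R^-1).
  move=> /le_trans; apply; rewrite lerD2l exprSr invfM mulrBr mulrCA lerBlDr lerDl.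
  by rewrite mulr_ge0 ?invr_ge0 ?exprn_ge0.
have a0 : 0 <= (m.+1%:R ^+ d)^-1 :> R by rewrite invr_ge0 exprn_ge0.
elim: i => [|i IH].
  rewrite addn0 zeta_sumS lerD2l !exprSr !invfM -mulrA ler_wpM2l //.
  set u := m.+1%:R^-1; have u0 : 0 <= u by rewrite invr_ge0.
  have u1 : u <= 1 by rewrite invf_le1 // ler1n.
  by nra.
rewrite addnS zeta_sumS; apply: le_trans (lerD IH (lexx _)) _.
set M := (m.+1 + i)%N; rewrite -addrA lerD2l.
have hM : (M.+1%:R ^+ d)^-1 <= (m.+1%:R ^+ d)^-1 :> R.
  by rewrite lef_pV2 ?posrE ?exprn_gt0 // lerXn2r ?nnegrE // ler_nat /M; lia.
have b0 : 0 <= (M.+1%:R ^+ d)^-1 :> R by rewrite invr_ge0 exprn_ge0.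
have -> : (M.+1%:R ^+ d.+2)^-1 = (M.+1%:R ^+ d)^-1 * (M.+1%:R^-1 * M.+1%:R^-1) :> R.
  by rewrite !exprSr !invfM mulrA.
have M0 : 0 < M%:R :> R by rewrite ltr0n.
have M1 : 0 < M.+1%:R :> R by rewrite ltr0n.
have key : M.+1%:R^-1 * M.+1%:R^-1 <= M%:R^-1 - M.+1%:R^-1 :> R.
  have -> : M%:R^-1 - M.+1%:R^-1 = M%:R^-1 * M.+1%:R^-1 :> R.
    by rewrite -[M.+1%:R]natr1; field; rewrite natr1 !lt0r_neq0.
  by rewrite ler_wpM2r ?invr_ge0 // lef_pV2 ?posrE // ler_nat.
have v0 : 0 <= M.+1%:R^-1 * M.+1%:R^-1 :> R by rewrite mulr_ge0 ?invr_ge0.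
apply: le_trans (lerD (lexx _) (ler_pM b0 v0 hM key)) _.
by rewrite -mulrDr addrA subrK.
Qed.

Lemma riemann_zeta_bounds d m :
  zeta_sum d.+1 m <= riemann_zeta (d.+2%:R : R) <=
  zeta_sum d.+1 m + 2 * (m.+1%:R ^+ d.+1)^-1.
Proof.
have -> : riemann_zeta (d.+2%:R : R) = limn (zeta_sum d.+1).
  rewrite /riemann_zeta; congr (limn _); apply/funext => N.
  rewrite /series /zeta_sum big_add1 /=; apply: eq_bigr => k _.
  by rewrite powR_mulrn.
have cv : cvgn (zeta_sum d.+1).
  apply: nondecreasing_is_cvgn; first exact: zeta_sum_homo.
  exists (zeta_sum d.+1 0 + 2 * (1%:R ^+ d.+1)^-1) => _ [N _ <-].
  exact: zeta_sum_tail.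
apply/andP; split; first by apply: nondecreasing_cvgn_le => //; apply: zeta_sum_homo.
apply: limr_le => //; near=> N; apply: zeta_sum_tail.
by near: N; apply: nbhs_infty_ge.
Unshelve. all: by end_near. Qed.

Lemma riemann_zeta_ge1 d : 1 <= riemann_zeta (d.+2%:R : R).
Proof.
have /andP[+ _] := riemann_zeta_bounds d 1; apply: le_trans.
by rewrite /zeta_sum big_nat1 expr1n invr1.
Qed.

Definition harmonic_sum N : R := \sum_(1 <= k < N.+1) k%:R^-1.

Lemma harmonic_sum_le N : (0 < N)%N -> harmonic_sum N <= 1 + ln N%:R.
Proof.
case: N => // N _; elim: N => [|N IH].
  by rewrite /harmonic_sum big_nat1 invr1 ln1 addr0.
rewrite /harmonic_sum big_nat_recr //= -/(harmonic_sum N.+1).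
apply: le_trans (lerD IH (lexx _)) _; rewrite -addrA lerD2l.
have N2 : 0 < N.+2%:R :> R by rewrite ltr0n.
have N1 : 0 < N.+1%:R :> R by rewrite ltr0n.
have e : N.+1%:R = (1 + - N.+2%:R^-1) * N.+2%:R :> R.
  by rewrite mulrDl mulNr mulVf ?gt_eqF // mul1r -[N.+2%:R]natr1 addrK.
have p : 0 < 1 + - N.+2%:R^-1 :> R by rewrite -(pmulr_lgt0 _ N2) -e.
rewrite {1}e lnM ?posrE // addrAC gerDr.
have n1 : -1 < - N.+2%:R^-1 :> R by rewrite -subr_gt0 opprK addrC.
by rewrite addrC -lerBrDl add0r; apply: le_ln1Dx.
Qed.

Lemma harmonic_sum_leN N : harmonic_sum N <= N%:R.
Proof.
rewrite /harmonic_sum -[X in _ <= X%:R](subn1 N.+1) -sumr_const_nat [leLHS]big_nat [leRHS]big_nat.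
by apply: ler_sum => k /andP[k0 _]; rewrite invf_le1 ?ler1n ?ltr0n.
Qed.

Definition moebius_dirichlet d N : R :=
  \sum_(1 <= k < N.+1) moebius R k * (k%:R ^+ d.+1)^-1.

(** The left side runs over the products k j up to N, and the divisor sums of
    the Moebius function leave only the term k j = 1: cutting the zeta series
    off at N/k makes the inverse relation exact. *)
Lemma moebius_zeta_sum d N : (0 < N)%N ->
  \sum_(1 <= k < N.+1) moebius R k * (k%:R ^+ d.+1)^-1 * zeta_sum d (N %/ k) = 1.
Proof.
move=> N0; have := moebius_sum (fun m => (m%:R ^+ d.+1)^-1 : R) N0.
rewrite expr1n invr1 => E; rewrite -[RHS]E; apply: eq_bigr => k _.
rewrite big_distrr /=; apply: eq_bigr => j _.
by rewrite natrM exprMn invfM mulrA.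
Qed.

(** By the preceding identity the difference is the sum of
    mu(k)/k^(d+2) (zeta(d+2) - zeta_sum (N/k)), where the tail of the zeta
    series is at most 2 (k/N)^(d+1). *)
Lemma moebius_dirichlet_approx d N : (0 < N)%N ->
  `|riemann_zeta (d.+2%:R : R) * moebius_dirichlet d.+1 N - 1| * N%:R ^+ d.+2 <=
  2 * N%:R * harmonic_sum N.
Proof.
move=> N0; have N0' : 0 < N%:R :> R by rewrite ltr0n.
rewrite -[X in _ - X](moebius_zeta_sum d.+1 N0) /moebius_dirichlet big_distrr /= -sumrB.
apply: (@le_trans _ _ (\sum_(1 <= k < N.+1) (2 * (N%:R ^+ d.+1)^-1 * k%:R^-1) * N%:R ^+ d.+2)).
  rewrite -[leRHS]big_distrl /= ler_wpM2r ?exprn_ge0 //.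
  apply: le_trans (ler_norm_sum _ _ _) _; rewrite [leLHS]big_nat [leRHS]big_nat.
  apply: ler_sum => k /andP[k0 kN]; have k0' : 0 < k%:R :> R by rewrite ltr0n.
  set Z := riemann_zeta _; set m := (N %/ k)%N.
  have -> : Z * (moebius R k * (k%:R ^+ d.+2)^-1) -
      moebius R k * (k%:R ^+ d.+2)^-1 * zeta_sum d.+1 m =
      moebius R k * ((k%:R ^+ d.+2)^-1 * (Z - zeta_sum d.+1 m)) by ring.
  have /andP[Z1 Z2] := riemann_zeta_bounds d m; rewrite -/Z in Z1 Z2.
  rewrite normrM; apply: le_trans (ler_wpM2r _ (normr_moebius_le1 R k)) _ => //.
  rewrite mul1r ger0_norm; last by rewrite mulr_ge0 ?subr_ge0 ?invr_ge0 ?exprn_ge0.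
  apply: (@le_trans _ _ ((k%:R ^+ d.+2)^-1 * (2 * (m.+1%:R ^+ d.+1)^-1))).
    by rewrite ler_wpM2l ?invr_ge0 ?exprn_ge0 // lerBlDl.
  have -> : (k%:R ^+ d.+2)^-1 * (2 * (m.+1%:R ^+ d.+1)^-1) =
      2 * ((k * m.+1)%:R ^+ d.+1)^-1 * k%:R^-1 :> R.
    by rewrite natrM exprMn [in LHS]exprS !invfM; ring.
  rewrite ler_wpM2r ?invr_ge0 // ler_wpM2l // lef_pV2 ?posrE ?exprn_gt0 ?ltr0n ?muln_gt0 ?k0 //.
  by rewrite lerXn2r ?nnegrE // ler_nat mulnC ltnW // ltn_ceil.
rewrite -big_distrl -big_distrr /= -/(harmonic_sum N) [N%:R ^+ d.+2]exprS.
have : N%:R ^+ d.+1 != 0 :> R by rewrite expf_neq0 ?gt_eqF.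
set u := N%:R ^+ d.+1 => u0; rewrite le_eqVlt; apply/orP; left; apply/eqP.
by field.
Qed.

(** The summatory function of the Jordan totient J_d, the number of elements of
    order m in (Z/m)^d. *)
Definition totient_sum d N : R :=
  \sum_(1 <= k < N.+1) moebius R k * powsum d (N %/ k).

Lemma totient_sum_approx d N :
  `|d.+1%:R * totient_sum d N - N%:R ^+ d.+1 * moebius_dirichlet d N| <=
  d.+1%:R * (N%:R ^+ d * \sum_(1 <= k < N.+1) (k%:R ^+ d)^-1).
Proof.
rewrite /totient_sum /moebius_dirichlet !big_distrr /= -sumrB.
apply: le_trans (ler_norm_sum _ _ _) _; rewrite [leLHS]big_nat [leRHS]big_nat.
apply: ler_sum => k /andP[k0 kN]; have k0' : 0 < k%:R :> R by rewrite ltr0n.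
have -> : d.+1%:R * (moebius R k * powsum d (N %/ k)) -
    N%:R ^+ d.+1 * (moebius R k * (k%:R ^+ d.+1)^-1) =
    moebius R k * (d.+1%:R * powsum d (N %/ k) - (N%:R / k%:R) ^+ d.+1).
  by rewrite expr_div_n; ring.
rewrite normrM; apply: le_trans (ler_wpM2r _ (normr_moebius_le1 R k)) _ => //.
rewrite mul1r -expr_div_n; apply: powsum_approx.
rewrite ler_pdivlMr // ltr_pdivrMr // -!natrM ler_nat ltr_nat.
by rewrite leq_divM ltn_ceil.
Qed.

Definition error_term d T : R := if d == 1%N then T * ln T else T ^+ d.

Lemma expR_le_ln_ge1 T : expR 1 <= T -> 1 <= ln T.
Proof. by move=> eT; rewrite -ler_expR lnK // posrE (lt_le_trans _ eT) ?expR_gt0. Qed.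

Lemma error_term_ge d T : expR 1 <= T -> T ^+ d <= error_term d T.
Proof.
move=> eT; have T0 : 0 <= T by apply: le_trans eT; apply: expR_ge0.
rewrite /error_term; case: eqP => // ->.
by rewrite expr1 ler_peMr // expR_le_ln_ge1.
Qed.

(** With s = d + 1 the error is of size N^s sum_k k^(-s) + N sum_k 1/k up to
    constants.  For s = 1 both sums are harmonic and produce the logarithm; for
    larger s the first one is bounded and the second one is at most N. *)
Lemma totient_sum_asymp d N T : (0 < N)%N -> N%:R <= T -> expR 1 <= T ->
  `|totient_sum d.+1 N - N%:R ^+ d.+2 / (d.+2%:R * riemann_zeta (d.+2%:R : R))| <=
  6 * error_term d.+1 T.
Proof.
move=> N0 NT eT; set Z := riemann_zeta _.
have Z1 : 1 <= Z by apply: riemann_zeta_ge1.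
have Z0 : 0 < Z by apply: lt_le_trans Z1.
have N0' : 0 <= N%:R :> R by [].
have N1 : 1 <= N%:R :> R by rewrite ler1n.
have T0 : 0 < T by apply: lt_le_trans eT; apply: expR_gt0.
have dn0 : d.+2%:R != 0 :> R by rewrite pnatr_eq0.
set S := \sum_(1 <= k < N.+1) (k%:R ^+ d.+1)^-1 : R.
set H := harmonic_sum N.
have H0 : 0 <= H by apply: sumr_ge0 => k _; rewrite invr_ge0.
have := moebius_dirichlet_approx d N0; rewrite -/Z -/H.
have := totient_sum_approx d.+1 N; rewrite -/S.
set Q := totient_sum _ _; set M := moebius_dirichlet _ _ => B1 B2.
apply: (@le_trans _ _ (N%:R ^+ d.+1 * S + 2 * N%:R * H)).
  have -> : Q - N%:R ^+ d.+2 / (d.+2%:R * Z) =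
      (d.+2%:R * Z)^-1 * (Z * (d.+2%:R * Q - N%:R ^+ d.+2 * M) +
        (Z * M - 1) * N%:R ^+ d.+2).
    by field; rewrite lt0r_neq0 //= -natrD.
  have c0 : 0 < d.+2%:R * Z by rewrite mulr_gt0 ?ltr0n.
  rewrite normrM gtr0_norm ?invr_gt0 // mulrC ler_pdivrMr //.
  apply: le_trans (ler_normD _ _) _; rewrite [leRHS]mulrDl; apply: lerD.
    rewrite normrM gtr0_norm // (_ : _ * (d.+2%:R * Z) = Z * (d.+2%:R * (N%:R ^+ d.+1 * S))).
      by rewrite ler_wpM2l // ltW.
    by ring.
  rewrite normrM [X in _ * X]ger0_norm ?exprn_ge0 //; apply: le_trans B2 _.
  rewrite ler_peMr ?mulr_ge0 // mulr_ege1 ?ler1n //.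
have HlN : H <= 1 + ln N%:R by apply: harmonic_sum_le.
have HN : H <= N%:R by apply: harmonic_sum_leN.
have lnT := expR_le_ln_ge1 eT.
have lnN : ln N%:R <= ln T by rewrite ler_ln ?posrE ?ltr0n.
move: @S {B1 B2 Q M Z Z1 Z0 dn0}; case: d => [|d] S; rewrite /error_term /=.
  have -> : S = H by apply: eq_bigr => k _; rewrite expr1.
  rewrite expr1; have : N%:R * H <= T * (2 * ln T) by rewrite ler_pM //; lra.
  by lra.
have S2 : S <= 2.
  have := @zeta_sum_tail d 0 N (leq0n N).
  by rewrite {2}/zeta_sum big_geq // add0r expr1n invr1 mulr1.
have NTd : N%:R ^+ d.+2 <= T ^+ d.+2 by rewrite lerXn2r ?nnegrE // ltW.
have NH : N%:R * H <= N%:R ^+ d.+2.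
  rewrite exprS ler_wpM2l // (le_trans HN) // exprS ler_peMr //.
  by rewrite exprn_ege1.
have Td : 0 <= T ^+ d.+2 by rewrite exprn_ge0 // ltW.
have : N%:R ^+ d.+2 * S <= N%:R ^+ d.+2 * 2 by rewrite ler_wpM2l ?exprn_ge0.
by lra.
Qed.

Lemma scaled_totient_sum_asymp d e T : (0 < e)%N -> e%:R <= T -> expR 1 <= T ->
  `|e%:R ^+ d.+1 * totient_sum d.+1 (Num.truncn T %/ e) -
    (d.+2%:R * riemann_zeta (d.+2%:R : R))^-1 * e%:R^-1 * T ^+ d.+2| <=
  7 * e%:R ^+ d.+1 * error_term d.+1 T.
Proof.
move=> e0 eT ET; have e0' : 0 < e%:R :> R by rewrite ltr0n.
have e1 : 1 <= e%:R :> R by rewrite ler1n.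
have T0 : 0 < T by apply: lt_le_trans eT.
have /andP[tT Tt] := truncn_itv (ltW T0); set t := Num.truncn T in tT Tt *.
set N := (t %/ e)%N.
have et : (e <= t)%N by rewrite truncn_ge_nat // ltW.
have N0 : (0 < N)%N by rewrite divn_gt0.
have NTe : N%:R <= T / e%:R.
  rewrite ler_pdivlMr // -natrM (le_trans _ tT) // ler_nat leq_divM //.
have TeN : T / e%:R < N.+1%:R.
  rewrite ltr_pdivrMr // -natrM (lt_le_trans Tt) // ler_nat ltn_ceil //.
have TeT : T / e%:R <= T by rewrite ler_pdivrMr // ler_peMr // ltW.
have Q1 := totient_sum_asymp d N0 (le_trans NTe TeT) ET.
set Q := totient_sum _ _ in Q1 *; set Z := riemann_zeta _ in Q1 *.
have Z1 : 1 <= Z by apply: riemann_zeta_ge1.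
have c0 : 0 < d.+2%:R * Z by rewrite mulr_gt0 ?ltr0n // (lt_le_trans _ Z1).
have N0' : 0 <= (N%:R : R) <= T / e%:R by rewrite ler0n NTe.
have /andP[D1 D2] := exprB_bounds d.+1 N0'.
have -> : e%:R ^+ d.+1 * Q - (d.+2%:R * Z)^-1 * e%:R^-1 * T ^+ d.+2 =
    e%:R ^+ d.+1 * (Q - N%:R ^+ d.+2 / (d.+2%:R * Z)) -
    e%:R ^+ d.+1 * ((d.+2%:R * Z)^-1 * ((T / e%:R) ^+ d.+2 - N%:R ^+ d.+2)).
  have -> : (d.+2%:R * Z)^-1 * e%:R^-1 * T ^+ d.+2 =
      e%:R ^+ d.+1 * ((d.+2%:R * Z)^-1 * (T / e%:R) ^+ d.+2).
    rewrite expr_div_n; have : e%:R ^+ d.+1 != 0 :> R by rewrite expf_neq0 ?gt_eqF.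
    rewrite [e%:R ^+ d.+2]exprS; set u := e%:R ^+ d.+1 => u0.
    set c := (_ * Z)^-1; have := lt0r_neq0 e0'; set v := e%:R => v0.
    by field; rewrite u0 v0.
  by ring.
apply: le_trans (ler_normB _ _) _; rewrite !normrM.
have -> : `|e%:R ^+ d.+1| = e%:R ^+ d.+1 :> R by rewrite ger0_norm ?exprn_ge0.
rewrite -mulrDr [7 * _ * _](mulrAC 7) [leRHS]mulrC ler_wpM2l ?exprn_ge0 //.
have -> : 7 * error_term d.+1 T = 6 * error_term d.+1 T + error_term d.+1 T by ring.
apply: lerD => //; apply: le_trans (error_term_ge d.+1 ET).
rewrite gtr0_norm ?invr_gt0 // mulrC ler_pdivrMr //.
have Te0 : 0 <= T / e%:R by rewrite divr_ge0 // ltW.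
have nn : 0 <= (T / e%:R) ^+ d.+2 - N%:R ^+ d.+2.
  by apply: le_trans D1; rewrite !mulr_ge0 ?exprn_ge0 ?subr_ge0.
rewrite ger0_norm //; apply: le_trans D2 _.
have le1 : T / e%:R - N%:R <= 1 by rewrite lerBlDr addrC natr1 ltW.
have p0 : 0 <= d.+2%:R * (T / e%:R) ^+ d.+1 by rewrite mulr_ge0 ?exprn_ge0.
apply: (@le_trans _ _ (d.+2%:R * (T / e%:R) ^+ d.+1)); first by rewrite ler_piMr.
rewrite [leRHS]mulrC -mulrA ler_wpM2l //.
apply: (@le_trans _ _ (T ^+ d.+1)); first by rewrite lerXn2r ?nnegrE // ltW.
by rewrite ler_peMl // exprn_ge0 // ltW.
Qed.

End Analytic.

(** * Counting torsion points by order *)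

Section Counting.
Variables (R : realType) (K : closedFieldType) (n : nat).
Hypothesis K_char0 : [pchar K] =i pred0.
Notation point := {ffun 'I_n -> K}.
Implicit Types (X Y C : set point) (T : R) (x w : point).

Lemma mem_torsion_upto X T x : 0 <= T ->
  (x \in fset_set (torsion_upto X T)) <->
  [/\ X x, torsion x & (tors_ord x <= Num.truncn T)%N].
Proof.
move=> T0; rewrite in_fset_set; last exact: finite_torsion_upto.
rewrite inE /torsion_upto /=; split=> -[Xx tx ox]; split=> //.
  by rewrite truncn_ge_nat.
by move: ox; rewrite truncn_ge_nat.
Qed.

Lemma count_killed_sum_ord X T N : 0 <= T -> (0 < N <= Num.truncn T)%N ->
  count_killed X N = (\sum_(x <- fset_set (torsion_upto X T)) (tors_ord x %| N))%N.
Proof.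
move=> T0 /andP[N0 NT].
rewrite (@count_killed_seq _ _ X N [seq x <- fset_set (torsion_upto X T) | (tors_ord x %| N)%N]).
- rewrite size_filter -sum1_count big_mkcond; apply: eq_bigr => x _.
  by case: (_ %| _)%N.
- by rewrite filter_uniq // fset_uniq.
move=> x; rewrite mem_filter; split.
  by move=> /andP[+ /(mem_torsion_upto _ _ T0)[Xx tx _]]; rewrite tors_ord_dvd // => /eqP.
move=> [Xx xN]; have tx := torsion_expr N0 xN.
have oN : (tors_ord x %| N)%N by rewrite tors_ord_dvd // xN.
rewrite oN; apply/(mem_torsion_upto _ _ T0); split=> //.
exact: leq_trans (dvdn_leq N0 oN) NT.
Qed.

Lemma torsion_upto_ord X T x : 0 <= T -> x \in fset_set (torsion_upto X T) ->
  (0 < tors_ord x <= Num.truncn T)%N.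
Proof.
move=> T0 /(mem_torsion_upto _ _ T0)[_ tx ->]; rewrite andbT.
by have [] := tors_ordP tx.
Qed.

Lemma count_torsion_le X T : 0 <= T ->
  (count_torsion X T <= \sum_(1 <= N < (Num.truncn T).+1) count_killed X N)%N.
Proof.
move=> T0; rewrite [leqRHS]big_nat.
rewrite (eq_bigr (fun N => \sum_(x <- fset_set (torsion_upto X T)) (tors_ord x %| N)))%N;
  last by move=> N; rewrite ltnS; apply: count_killed_sum_ord.
rewrite -big_nat exchange_big /= /count_torsion -sum1_size.
rewrite big_seq [leqRHS]big_seq leq_sum // => x xE.
have oE : tors_ord x \in index_iota 1 (Num.truncn T).+1.
  by rewrite mem_index_iota ltnS; apply: torsion_upto_ord xE.
by rewrite (big_rem _ oE) /= dvdnn.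
Qed.

(** Moebius inversion over the order: a torsion point of order o is killed by
    the multiples of o, and sum_k mu(k) floor(floor(t/o)/k) is 1 for o <= t. *)
Lemma count_torsion_moebius X T : 0 <= T ->
  (count_torsion X T)%:R = \sum_(1 <= k < (Num.truncn T).+1)
    moebius R k * \sum_(1 <= N < (Num.truncn T %/ k).+1) (count_killed X N)%:R.
Proof.
move=> T0; set t := Num.truncn T; set E := fset_set (torsion_upto X T).
transitivity (\sum_(1 <= k < t.+1) \sum_(x <- E)
    moebius R k * (t %/ tors_ord x %/ k)%:R).
  rewrite exchange_big /= big_seq (eq_bigr (fun=> 1)); last first.
    move=> x xE; have /andP[pos ot] := torsion_upto_ord T0 xE.
    by apply: moebius_sum_divn; rewrite divn_gt0 // ot leq_div.
  by rewrite -big_seq /count_torsion -sum1_size natr_sum.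
apply: eq_big_nat => k /andP[k0 kt]; rewrite -big_distrr /=; congr (_ * _).
transitivity (\sum_(1 <= N < (t %/ k).+1) \sum_(x <- E) (tors_ord x %| N)%:R : R).
  rewrite exchange_big /=; apply: eq_big_seq => x xE.
  have /andP[pos _] := torsion_upto_ord T0 xE.
  have nat_sum M : M%:R = \sum_(1 <= j < M.+1) 1 :> R by rewrite sumr_const_nat subn1.
  rewrite divnAC nat_sum -(sum_multiples _ (fun=> 1) pos) big_mkcond /=.
  by apply: eq_bigr => N _; case: (_ %| _)%N.
apply: eq_big_nat => N /andP[N0 Nt]; rewrite (count_killed_sum_ord _ T0) ?natr_sum // N0 /=.
by rewrite -/t (leq_trans _ (leq_div t k)).
Qed.

Lemma count_torsion_coset A w (J : {set 'I_n}) T : A \in unitmx -> torsion w ->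
    (forall i, i \notin J -> w i = 1) -> 0 <= T ->
  (count_torsion (coset A w J) T)%:R = (tors_ord w)%:R ^+ #|~: J| *
    totient_sum R #|~: J| (Num.truncn T %/ tors_ord w).
Proof.
move=> uA tw w1 T0; rewrite count_torsion_moebius //.
set t := Num.truncn T; set d := #|~: J|; set e := tors_ord w.
have e0 : (0 < e)%N by have [] := tors_ordP tw.
rewrite /totient_sum.
rewrite -(@sum_divn_truncate R t (t %/ e) (moebius R) (powsum R d)); last first.
- exact: leq_div.
- by rewrite /powsum big_geq.
rewrite big_distrr /=; apply: eq_bigr => k _; rewrite mulrCA; congr (_ * _).
rewrite divnAC /powsum big_distrr /=.
transitivity (\sum_(1 <= N < (t %/ k).+1 | (e %| N)%N) N%:R ^+ d : R).
  rewrite [RHS]big_mkcond; apply: eq_big_nat => N /andP[N0 _].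
  by rewrite count_killed_coset // -/e; case: ifP => _; rewrite ?natrX.
rewrite sum_multiples //; apply: eq_bigr => j _.
by rewrite natrM exprMn.
Qed.

Lemma count_torsion_le_expn X T c d : 0 <= T ->
    (forall N, (0 < N)%N -> (count_killed X N <= c * N ^ d)%N) ->
  (count_torsion X T)%:R <= c%:R * T ^+ d.+1.
Proof.
move=> T0 Xc; have /andP[tT _] := truncn_itv T0; set t := Num.truncn T in tT.
apply: (@le_trans _ _ (c * t ^ d.+1)%:R); last first.
  by rewrite natrM natrX ler_wpM2l // lerXn2r ?nnegrE.
rewrite ler_nat (leq_trans (count_torsion_le X T0)) // -/t.
apply: (@leq_trans (\sum_(1 <= N < t.+1) c * t ^ d)).
  rewrite [leqLHS]big_nat [leqRHS]big_nat leq_sum // => N /andP[N0 Nt].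
  rewrite (leq_trans (Xc N N0)) // leq_mul2l; apply/orP; right.
  by case: d {Xc} => // d; rewrite leq_exp2r.
by rewrite sum_nat_const_nat subn1 /= expnS mulnCA.
Qed.

(** Here the formula reduces to sum_k mu(k) floor(N/k), which is 1 or 0. *)
Lemma torsion_coset_dim0 C T : torsion_coset C -> krull_dim C = 0%N -> 0 <= T ->
  (count_torsion C T)%:R <= 1 :> R.
Proof.
move=> /(torsion_coset_coset K_char0)[A [w [J [uA tw w1 ->]]]].
rewrite krull_dim_coset //; last by case: tw.
move=> d0 T0; rewrite count_torsion_coset // d0 mul1r; set N := (_ %/ _)%N.
rewrite /totient_sum (eq_bigr (fun k => moebius R k * (N %/ k)%:R)); last first.
  move=> k _; rewrite /powsum (eq_bigr (fun=> 1)) => [|j _]; last exact: expr0.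
  by rewrite sumr_const_nat subn1.
have [->|N0] := posnP N; first by rewrite big_geq // ler01.
by rewrite moebius_sum_divn // N0 leqnn.
Qed.

Lemma torsion_coset_asymp C a : torsion_coset C -> (krull_dim C <= a)%N ->
    (0 < a)%N ->
  exists c : R, forall T, expR 1 + (coset_ord C)%:R <= T ->
    `|(count_torsion C T)%:R -
       (if krull_dim C == a then
          (a.+1%:R * riemann_zeta a.+1%:R)^-1 * (coset_ord C)%:R^-1 * T ^+ a.+1
        else 0)| <= c * error_term a T.
Proof.
move=> /(torsion_coset_coset K_char0)[A [w [J [uA tw w1 ->]]]].
rewrite krull_dim_coset //; last by case: tw.
rewrite coset_ord_coset //; set d := #|~: J|; set e := tors_ord w => da a0.
have e0 : (0 < e)%N by have [] := tors_ordP tw.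
have large T : expR 1 + e%:R <= T -> [/\ expR 1 <= T, e%:R <= T & 0 <= T].
  move=> eT; have : (0 : R) < expR 1 by apply: expR_gt0.
  have : (0 : R) <= e%:R by [].
  by split; lra.
have [ad|ad] := eqVneq d a.
  exists (7 * e%:R ^+ a) => T /large[ET eT T0].
  rewrite count_torsion_coset // -/d -/e ad; case: a a0 {da ad} => // a _.
  exact: scaled_totient_sum_asymp.
exists 1 => T /large[ET eT T0]; rewrite subr0 ger0_norm // mul1r.
apply: le_trans (error_term_ge a ET).
have T1 : 1 <= T by apply: le_trans ET; rewrite ltW ?expR_gt1.
apply: (@le_trans _ _ (1%:R * T ^+ d.+1)).
  apply: count_torsion_le_expn => // N N0; rewrite count_killed_coset // mul1n.
  by case: ifP.
by rewrite mul1r ler_weXn2l // ltn_neqAle ad.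
Qed.

Lemma torsion_coset_inter_count C C' a : torsion_coset C -> torsion_coset C' ->
    ~ (C `<=` C') -> (krull_dim C <= a)%N -> (0 < a)%N ->
  exists c : R, forall T, expR 1 <= T ->
    (count_torsion (C `&` C') T)%:R <= c * error_term a T.
Proof.
move=> /(torsion_coset_coset K_char0)[A [w [J [uA tw w1 ->]]]].
move=> /(torsion_coset_coset K_char0)[A' [w' [J' [uA' tw' w1' ->]]]].
rewrite krull_dim_coset //; last by case: tw.
move=> nsub da a0; have [c cP] := count_killed_proper_coset K_char0 uA tw w1 nsub.
exists c%:R => T ET; have T1 : 1 <= T by apply: le_trans ET; rewrite ltW ?expR_gt1.
have T0 : 0 <= T by apply: le_trans T1.
apply: le_trans (count_torsion_le_expn T0 cP) _; rewrite ler_wpM2l //.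
apply: le_trans (error_term_ge a ET); rewrite ler_weXn2l //.
by case: #|_| da.
Qed.

(** A point that lies on c >= 1 of the sets C i is counted c times in their sum,
    and c <= 1 + c (c - 1). *)
Lemma count_torsion_bigcup (m : nat) (C : 'I_m -> set point) X T :
    (forall x, torsion x -> X x <-> exists i, C i x) -> 0 <= T ->
  (count_torsion X T)%:R <= \sum_i (count_torsion (C i) T)%:R :> R /\
  \sum_i (count_torsion (C i) T)%:R <= (count_torsion X T)%:R +
    \sum_i \sum_(j | j != i) (count_torsion (C i `&` C j) T)%:R :> R.
Proof.
move=> XC T0; set E := fset_set (torsion_upto X T).
have cntE Y : (forall x, torsion x -> Y x -> X x) ->
    count_torsion Y T = (\sum_(x <- E) `[< Y x >])%N.
  move=> YX; rewrite /count_torsion.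
  transitivity (size [seq x <- E | `[< Y x >]]).
    apply/perm_size/uniq_perm; rewrite ?filter_uniq ?fset_uniq // => x.
    rewrite mem_filter; apply/idP/andP.
      move=> /(mem_torsion_upto _ _ T0)[Yx tx ox]; split; first exact/asboolP.
      by apply/(mem_torsion_upto _ _ T0); split=> //; apply: YX.
    move=> [/asboolP Yx /(mem_torsion_upto _ _ T0)[_ tx ox]].
    exact/(mem_torsion_upto _ _ T0).
  rewrite size_filter -sum1_count big_mkcond; apply: eq_bigr => x _.
  by case: asbool.
have CX i x : torsion x -> C i x -> X x by move=> tx Cx; apply/XC => //; exists i.
have cntC i := cntE (C i) (CX i).
have cntCC i j : count_torsion (C i `&` C j) T = (\sum_(x <- E) `[< C i x >] * `[< C j x >])%N.
  rewrite cntE; last by move=> x tx [/(CX i x tx)].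
  apply: eq_bigr => x _.
  by rewrite asbool_and; case: asbool; case: asbool.
have cntX : count_torsion X T = (\sum_(x <- E) 1)%N by rewrite sum1_size.
have cover x : x \in E -> exists i, C i x.
  by move=> /(mem_torsion_upto _ _ T0)[Xx tx _]; apply/XC.
split.
  rewrite -natr_sum ler_nat cntX (eq_bigr _ (fun i _ => cntC i)) exchange_big /=.
  rewrite [leqLHS]big_seq [leqRHS]big_seq leq_sum // => x /cover[i Cx].
  by rewrite (bigD1 i) //= asboolT.
under [X in _ <= _ + X]eq_bigr do rewrite -natr_sum.
rewrite -!natr_sum -natrD ler_nat cntX (eq_bigr _ (fun i _ => cntC i)).
rewrite [X in (_ <= _ + X)%N](eq_bigr (fun i => \sum_(x <- E) \sum_(j | j != i) `[< C i x >] * `[< C j x >])%N);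
  last by move=> i _; rewrite exchange_big /=; apply: eq_bigr => j _; rewrite cntCC.
rewrite exchange_big [X in (_ <= _ + X)%N]exchange_big /= -big_split /=.
rewrite [leqLHS]big_seq [leqRHS]big_seq leq_sum // => x /cover[i0 Cx].
rewrite (bigD1 i0) //= asboolT // leq_add2l.
rewrite [leqRHS](bigD1 i0) //= (leq_trans _ (leq_addl _ _)) // leq_sum // => i ii0.
by rewrite (bigD1 i0) 1?eq_sym //= (asboolT Cx) muln1 leq_addr.
Qed.

End Counting.

Section Components.
Variables (K : fieldType) (n : nat).
Notation point := {ffun 'I_n -> K}.

(** Components are maximal among the irreducible subsets of Y. *)
Lemma component_sub_eq (m : nat) (Y : set point) (C : 'I_m -> set point) i j :
  irreducible_decomposition Y C -> C i `<=` C j -> i = j.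
Proof.
move=> [Cinj Crange _] Cij.
have comp k : irreducible_component Y (C k) by rewrite -Crange; exists k.
have [_ _ max] := comp i; have [jY jirr _] := comp j.
by apply: Cinj; rewrite (max (C j)).
Qed.

Lemma torsion_closure (X : set point) x : algebraic X -> torsion x ->
  X x <-> zariski_closure (X `&` @torsion K n) x.
Proof.
move=> algX tx; split=> [Xx Z _|]; first by apply; split.
by move=> /(_ X algX); apply=> y [].
Qed.

End Components.

Theorem corollary1p5 (R : realType) (K : closedFieldType)
    (K_char0 : [pchar K] =i pred0) (n : nat)
    (X : set {ffun 'I_n -> K}) (X_alg : algebraic X)
    (X_tors : X `&` @torsion K n !=set0)
    (m : nat) (C : 'I_m -> set {ffun 'I_n -> K})
    (C_coset : forall i, torsion_coset (C i))
    (C_decomp :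
       irreducible_decomposition (zariski_closure (X `&` @torsion K n)) C) :
  let a := (\max_(i < m) krull_dim (C i))%N in
  let b : R := ((a.+1)%:R * riemann_zeta (a.+1)%:R)^-1 *
               \sum_(i < m | krull_dim (C i) == a) ((coset_ord (C i))%:R)^-1 in
  (a = 0%N ->
     exists c : R, forall T : R, 1 <= T -> (count_torsion X T)%:R <= c) /\
  ((1 <= a)%N ->
     exists c : R, \forall T \near +oo,
       `|(count_torsion X T)%:R - b * T ^+ a.+1|
         <= c * (if a == 1%N then T * ln T else T ^+ a)).
Proof.
have [_ _ Y_cover] := C_decomp.
have cover x : torsion x -> X x <-> exists i, C i x.
  move=> tx; rewrite (torsion_closure X_alg tx) Y_cover.
  by split=> [[i _ Ci]|[i Ci]]; exists i.
move=> a b.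
have dim_le i : (krull_dim (C i) <= a)%N.
  exact: (@leq_bigmax _ (fun i => krull_dim (C i)) i).
split=> [a0|a_gt0].
  exists m%:R => T T1; have T0 : 0 <= T by apply: le_trans T1.
  have [le_sum _] := count_torsion_bigcup cover T0.
  apply: le_trans le_sum _; rewrite -[X in _ <= X%:R]card_ord -sumr_const.
  apply: ler_sum => i _; apply: torsion_coset_dim0 => //.
  by apply/eqP; rewrite -leqn0 -a0.
have /choice[c cP] i := torsion_coset_asymp R K_char0 (C_coset i) (dim_le i) a_gt0.
have /choice[c2 c2P] (ij : 'I_m * 'I_m) : exists c : R, forall T, expR 1 <= T ->
    ij.2 != ij.1 ->
    (count_torsion (C ij.1 `&` C ij.2) T)%:R <= c * error_term a T.
  have [->|ne] := eqVneq ij.2 ij.1; first by exists 0.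
  have nsub : ~ C ij.1 `<=` C ij.2.
    by move=> /(component_sub_eq C_decomp)/eqP; rewrite eq_sym (negPf ne).
  have [c' c'P] := torsion_coset_inter_count R K_char0 (C_coset ij.1) (C_coset ij.2)
    nsub (dim_le ij.1) a_gt0.
  by exists c' => T eT _; apply: c'P.
pose S1 := \sum_i c i.
pose S2 := \sum_i \sum_(j | j != i) c2 (i, j).
exists (S1 + S2); near=> T.
have eT : expR 1 <= T by near: T; apply: nbhs_pinfty_ge; apply: num_real.
have T0 : 0 <= T by apply: le_trans eT; apply: expR_ge0.
have oT i : expR 1 + (coset_ord (C i))%:R <= T.
  apply: (@le_trans _ _ (expR 1 + \sum_i (coset_ord (C i))%:R)).
    by rewrite lerD2l (bigD1 i) //= lerDl sumr_ge0.
  by near: T; apply: nbhs_pinfty_ge; apply: num_real.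
change (if a == 1%N then T * ln T else T ^+ a) with (error_term a T).
have [le_sum ge_sum] := count_torsion_bigcup cover T0.
pose term i := if krull_dim (C i) == a then
  (a.+1%:R * riemann_zeta a.+1%:R)^-1 * (coset_ord (C i))%:R^-1 * T ^+ a.+1 else 0 : R.
have -> : b * T ^+ a.+1 = \sum_i term i.
  rewrite /b big_distrr big_distrl /= big_mkcond; apply: eq_bigr => i _.
  by rewrite /term; case: ifP.
set cnt := (count_torsion X T)%:R in le_sum ge_sum *.
set sumC := \sum_i _ in le_sum ge_sum.
have E1 : `|sumC - \sum_i term i| <= S1 * error_term a T.
  rewrite /sumC -sumrB /S1 big_distrl /=; apply: le_trans (ler_norm_sum _ _ _) _.
  by apply: ler_sum => i _; apply: cP.
have E2 : \sum_i \sum_(j | j != i) (count_torsion (C i `&` C j) T)%:R <=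
    S2 * error_term a T.
  rewrite /S2 big_distrl /=; apply: ler_sum => i _; rewrite big_distrl /=.
  by apply: ler_sum => j ji; apply: (c2P (i, j)).
rewrite mulrDl; move: E1; rewrite !ler_norml => /andP[E11 E12].
by apply/andP; split; lra.
Unshelve. all: by end_near. Qed.
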